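(* Let $\mathcal{H}_k$ be an admissible space of power series on $\mathbb{D}$ with the complete Pick property, and let $\mathcal{M}_k$ be its multiplier algebra. If there is a (necessarily unique) $\varrho$ with $1/3\le\varrho<1$ such that $k(\varrho,\varrho)=9/8$, then \[\mathcal{B}(\mathcal{M}_k)=\{z\in\mathbb{D}\,:\,|z|\le\varrho\}.\] Otherwise, $\mathcal{B}(\mathcal{M}_k)=\mathbb{D}$. Moreover, $\varrho=1/3$ (that is, such a $\varrho$ exists and equals $1/3$) if and only if $k$ is the Szeg\H{o} kernel $k(z,w)=\dfrac{1}{1-\overline{w}z}$.
   Context: $\mathbb{D}$ is the open unit disc in $\mathbb{C}$. An admissible space of power series is a reproducing kernel Hilbert space $\mathcal{H}_k$ on $\mathbb{D}$ whose reproducing kernel is \[k(z,w)=\sum_{j=0}^\infty b_j(\overline{w}z)^j,\qquad b_0=1,\quad b_j>0\text{ for all }j,\] where the power series $\sum_{j\ge0}b_jz^j$ has radius of convergence exactly $1$. The monomials $e_j(z)=z^j$, $j=0,1,2,\ldots$, form an orthogonal basis of $\mathcal{H}_k$ with $\|e_j\|_{\mathcal{H}_k}^2=1/b_j$. Multiplier algebra: $\mathcal{M}_k$ consists of the functions $\varphi$ on $\mathbb{D}$ such that $M_\varphi:f\mapsto\varphi f$ is a bounded linear operator on $\mathcal{H}_k$, with $\|\varphi\|_{\mathcal{M}_k}=\|M_\varphi\|$; one has $\mathcal{M}_k\subseteq\mathcal{H}_k$, so each $\varphi\in\mathcal{M}_k$ has a power series $\varphi(z)=\sum_{j\ge0}\widehat{\varphi}(j)z^j$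 in $\mathbb{D}$. Its majorant is $M\varphi(z)=\sum_{j\ge0}|\widehat{\varphi}(j)z^j|$, and the Bohr set is \[\mathcal{B}(\mathcal{M}_k)=\{z\in\mathbb{D}: M\varphi(z)\le\|\varphi\|_{\mathcal{M}_k}\text{ for every }\varphi\in\mathcal{M}_k\}.\] Complete Pick property (standard notion): for all positive integers $n,s$, all points $x_1,\ldots,x_n\in\mathbb{D}$ and all complex $s\times s$ matrices $W_1,\ldots,W_n$ such that the block matrix $\big[k(x_i,x_j)(I-W_iW_j^* )\big]_{i,j=1}^n$ is positive semi-definite, there is an $s\times s$ matrix-valued function $\Phi$ with entries in $\mathcal{M}_k$ such that $\Phi(x_i)=W_i$ for every $i$ and multiplication by $\Phi$ on $\mathcal{H}_k\otimes\mathbb{C}^s$ has operator norm at most $1$. *)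

(* Defs.v *)
From HB Require Import structures.
From mathcomp Require Import all_boot all_order all_algebra.
From mathcomp Require Import all_classical all_reals all_analysis.
From mathcomp Require Import complex.

Set Implicit Arguments.
Unset Strict Implicit.
Unset Printing Implicit Defensive.

Import Order.TTheory GRing.Theory Num.Theory Num.Def.
Import numFieldNormedType.Exports.

Local Open Scope classical_set_scope.
Local Open Scope sesquilinear_scope.
Local Open Scope ring_scope.

(* The norm of R[i] takes its values in R[i] and the order of R[i] compares only
   numbers with the same imaginary part; hence `|z| < 1 is the usual condition
   and 0 <= z says that z is real and nonnegative. The topology of R[i] is
   carried by the alias R[i]^o. *)
Definition disc (R : realType) : Type := {z : R[i] | `|z| < 1}.

Section PowerSeriesKernel.
Variable R : realType.

Definition radius_of_convergence (b : nat -> R) : \bar R :=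
  ereal_sup [set `|x|%:E | x in [set x : R | cvgn (pseries b x)]].

Definition admissible (b : nat -> R) : Prop :=
  [/\ b 0%N = 1, forall j, 0 < b j & radius_of_convergence b = 1%E].

Definition ps_kernel (b : nat -> R) (z w : R[i]) : R[i] :=
  limn (series (fun j => (b j)%:C%C * (w^* * z) ^+ j : R[i]^o)).

Definition disc_kernel (b : nat -> R) (z w : disc R) : R[i] :=
  ps_kernel b (sval z) (sval w).

End PowerSeriesKernel.

(* A Hilbert space of functions on X with reproducing kernel k; the vector f is
   identified with the function rkhs_fun f. Inner products are linear in the
   first argument and conjugate-linear in the second. *)
Record rkhs (R : realType) (X : Type) (k : X -> X -> R[i]) := Rkhs {
  rkhs_space :> completeNormedModType R[i];
  rkhs_dot : {dot rkhs_space for conjC};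
  rkhs_norm_dot : forall f, `|f| ^+ 2 = rkhs_dot f f;
  rkhs_fun : {linear rkhs_space -> (X -> R[i])};
  rkhs_fun_inj : injective rkhs_fun;
  rkhs_reproducing : forall w, exists2 kw : rkhs_space,
    rkhs_fun kw = k^~ w & forall f, rkhs_fun f w = rkhs_dot f kw
}.

Section Multipliers.
Variables (R : realType) (X : Type) (k : X -> X -> R[i]) (H : rkhs k).

(* g = M_phi f *)
Definition mul_graph (phi : X -> R[i]) (f g : H) : Prop :=
  rkhs_fun H g = phi \* rkhs_fun H f.

Definition mul_bound (phi : X -> R[i]) (c : R) : Prop :=
  0 <= c /\ forall f g : H, mul_graph phi f g -> `|g| <= c%:C%C * `|f|.

Definition is_multiplier (phi : X -> R[i]) : Prop :=
  (forall f : H, exists g : H, mul_graph phi f g) /\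
  (exists c : R, mul_bound phi c).

Definition mult_norm (phi : X -> R[i]) : R := inf [set c | mul_bound phi c].

Definition psdmx n (A : 'M[R[i]]_n) : Prop :=
  forall v : 'cV[R[i]]_n, 0 <= (v ^t* *m A *m v) 0 0.

(* The tensor product of H with C^s is H^s, columns of s vectors of H with
   squared norm the sum of the squared norms of the entries. *)
Definition mx_mul_contractive s (Phi : X -> 'M[R[i]]_s) : Prop :=
  forall f g : 'I_s -> H,
    (forall p, rkhs_fun H (g p) = fun x => \sum_q Phi x p q * rkhs_fun H (f q) x) ->
    \sum_p `|g p| ^+ 2 <= \sum_q `|f q| ^+ 2.

Definition complete_pick : Prop :=
  forall n s : nat, (0 < n)%N -> (0 < s)%N ->
  forall (x : 'I_n -> X) (W : 'I_n -> 'M[R[i]]_s),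
    psdmx (\mxblock_(i < n, j < n)
             (k (x i) (x j) *: (1%:M - W i *m (W j) ^t*))) ->
    exists Phi : X -> 'M[R[i]]_s,
      [/\ forall p q, is_multiplier (fun z => Phi z p q),
          forall i, Phi (x i) = W i
        & mx_mul_contractive Phi].

End Multipliers.

Section Bohr.
Variable R : realType.

Definition has_power_series (phi : disc R -> R[i]) (a : nat -> R[i]) : Prop :=
  forall z : disc R,
    series (fun j => a j * sval z ^+ j : R[i]^o) @ \oo --> (phi z : R[i]^o).

(* The default value 0 is irrelevant for functions with a power series. *)
Definition taylor_coef (phi : disc R -> R[i]) : nat -> R[i] :=
  xget (fun=> 0) [set a | has_power_series phi a].

Definition majorant (phi : disc R -> R[i]) (z : disc R) : \bar R :=
  (\sum_(0 <= j <oo) (complex.Re `|taylor_coef phi j * sval z ^+ j|)%:E)%E.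

Definition bohr_set (k : disc R -> disc R -> R[i]) (H : rkhs k) :
    set (disc R) :=
  [set z | forall phi, is_multiplier H phi ->
             (majorant phi z <= (mult_norm H phi)%:E)%E].

Definition bohr_rho (b : nat -> R) (rho : R) : Prop :=
  1 / 3 <= rho < 1 /\ ps_kernel b rho%:C%C rho%:C%C = (9 / 8)%:C%C.

End Bohr.

(* Main.v *)
Require Import Defs.
From HB Require Import structures.
From mathcomp Require Import all_boot all_order all_algebra.
From mathcomp Require Import separable cyclotomic.
From mathcomp Require Import all_classical all_reals all_analysis.
From mathcomp Require Import complex ring lra zify.
Set Implicit Arguments.
Unset Strict Implicit.
Unset Printing Implicit Defensive.
Import Order.TTheory GRing.Theory Num.Theory Num.Def.
Import numFieldNormedType.Exports.
Local Open Scope classical_set_scope.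
Local Open Scope sesquilinear_scope.
Local Open Scope ring_scope.

(* Write 1 - 1/k = F with F(t) = sum_(n >= 1) c_n t^n in t = z conj(w).

   The complete Pick property forces c_n >= 0. By induction on n, interpolate at
   the points eps w^i, w a primitive n-th root of unity, the row
   (sqrt(theta c_q) z^q)_(q < n) with theta < 1; the Pick matrix is circulant with
   positive leading eigenvalues, hence positive for small eps. The coefficients of
   the interpolating row multiplier tend to sqrt(theta c_q) as eps -> 0, and its
   contractivity, tested against z^n, gives sum_(q < n) c_q b_(n-q) <= b_n.

   If phi has multiplier norm at most M and coefficients a_j, the form
   D(xi) = M^2 |xi|^2 - |T^* xi|^2, T multiplication by phi, is nonnegative and, since b = 1 + c * b, satisfies
   D(xi) = M^2 |xi_0|^2 - |sum xi_i a_i|^2 + sum_m c_m D(S^m xi), S the backward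
   shift. When sum c_m r^(2m) <= 1/9, that is, k(r,r) <= 9/8, induction on the
   length of xi gives 4 D(xi) <= M^2 - |a_0|^2 for xi_0 = 0 and |xi_i| <= r^i; the
   Cauchy-Schwarz inequality with e_0 then gives
   2 M |sum xi_i a_i| <= M^2 - |a_0|^2, hence sum |a_j| r^j <= M.

   If k(z,z) > 9/8, put s = sqrt(1 - 1/k(z,z)) > 1/3 and interpolate the values a at
   0 and (a - s)/(1 - a s) at z: the majorant exceeds 1 at z when s (1 + 2 a) > 1.

   Finally sum c_n <= 1, so F(1/9) <= 1/9 with equality only for the Szego kernel. *)

(** * Complex sequences and power series *)

Section ComplexSequences.
Variable R : realType.
Implicit Types (z t : R[i]) (x : R).

Lemma normc_real x : `|x%:C%C : R[i]| = `|x|%:C%C.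
Proof. by rewrite normc_def /= expr0n addr0 sqrtr_sqr. Qed.

Lemma normc_RRe z : (complex.Re `|z|)%:C%C = `|z|.
Proof. by apply: RRe_real; exact: normr_real. Qed.

Lemma gt0_complexP (e : R[i]) : 0 < e -> exists2 x : R, e = x%:C%C & 0 < x.
Proof.
case: e => a b; rewrite ltcE /= => /andP[/eqP -> a0].
by exists a.
Qed.

Lemma ge0_complexP (e : R[i]) : 0 <= e -> exists2 x : R, e = x%:C%C & 0 <= x.
Proof.
case: e => a b; rewrite lecE /= => /andP[/eqP -> a0].
by exists a.
Qed.

Lemma cvg_real_complex (u : R^nat) (l : R) : u @ \oo --> l ->
  (fun n => (u n)%:C%C : R[i]^o) @ \oo --> (l%:C%C : R[i]^o).
Proof.
move=> /cvgrPdist_lt ul; apply/cvgrPdist_lt => e /gt0_complexP[x -> x0].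
apply: filterS (ul _ x0) => n.
by rewrite -rmorphB /= normc_real ltcR.
Qed.

Lemma cvg_complexP (u : nat -> R[i]) (l : R[i]) :
  (u : nat -> R[i]^o) @ \oo --> (l : R[i]^o) <->
  forall e : R, 0 < e ->
    exists N, forall n, (N <= n)%N -> `|l - u n| < e%:C%C.
Proof.
split=> [/cvgrPdist_lt ul e e0|ul].
  have [|N _ HN] := ul e%:C%C; first by rewrite ltcR.
  by exists N => n Nn; exact: HN.
apply/cvgrPdist_lt => e /gt0_complexP[x -> /ul[N HN]].
by exists N => // n /=; exact: HN.
Qed.

Lemma cvg_complex_cst (a : R[i]) :
  (fun=> a : R[i]^o) @ \oo --> (a : R[i]^o).
Proof.
by apply/cvg_complexP => e e0; exists 0%N => m _; rewrite subrr normr0 ltcR.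
Qed.

Lemma cvg_complexD (u v : nat -> R[i]) (a b : R[i]) :
  (u : nat -> R[i]^o) @ \oo --> (a : R[i]^o) ->
  (v : nat -> R[i]^o) @ \oo --> (b : R[i]^o) ->
  (fun n => u n + v n : R[i]^o) @ \oo --> (a + b : R[i]^o).
Proof.
move=> /cvg_complexP ua /cvg_complexP vb; apply/cvg_complexP => e e0.
have e20 : 0 < e / 2 by lra.
have [N HN] := ua _ e20; have [M HM] := vb _ e20.
exists (maxn N M) => n; rewrite geq_max => /andP[/HN h1 /HM h2].
rewrite opprD addrACA (le_lt_trans (ler_normD _ _))//.
by rewrite [e]splitr rmorphD ltrD.
Qed.

Lemma cvg_complexMl (u : nat -> R[i]) (c a : R[i]) :
  (u : nat -> R[i]^o) @ \oo --> (a : R[i]^o) ->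
  (fun n => c * u n : R[i]^o) @ \oo --> (c * a : R[i]^o).
Proof.
move=> /cvg_complexP ua; apply/cvg_complexP => e e0.
have c0 : 0 < complex.Re `|c| + 1.
  by rewrite ltr_wpDl// -ler0c normc_RRe.
have [N HN] := ua _ (divr_gt0 e0 c0).
exists N => n /HN h; rewrite -mulrBr normrM.
rewrite (@le_lt_trans _ _ ((complex.Re `|c| + 1)%:C%C * `|a - u n|))//.
  by rewrite ler_wpM2r// rmorphD /= normc_RRe lerDl.
by rewrite -ltr_pdivlMl ?ltcR// mulrC -fmorphV -rmorphM.
Qed.

Lemma cvg_complex_norm_le (u : nat -> R[i]) (l M : R[i]) (N : nat) :
  (u : nat -> R[i]^o) @ \oo --> (l : R[i]^o) ->
  (forall n, (N <= n)%N -> `|u n| <= M) -> `|l| <= M.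
Proof.
move=> /cvg_complexP ul uM.
have M0 : 0 <= M by apply: le_trans (uM _ (leqnn N)).
rewrite real_leNgt ?normr_real ?ger0_real//; apply/negP => Ml.
have /gt0_complexP[e ee e0] : 0 < `|l| - M by rewrite subr_gt0.
have [N' HN'] := ul _ e0.
have := HN' _ (leq_maxr N N'); apply/negP; rewrite -real_leNgt ?normr_real//; last first.
  by rewrite -ee realB ?normr_real// ger0_real.
rewrite -ee lerBlDr (le_trans _ (lerD (lexx _) (uM _ (leq_maxl N N'))))//.
by rewrite -[X in `|X|](subrK (u (maxn N N'))) ler_normD.
Qed.

Lemma cvg_complex_unique (u : nat -> R[i]) (a b : R[i]) :
  (u : nat -> R[i]^o) @ \oo --> (a : R[i]^o) ->
  (u : nat -> R[i]^o) @ \oo --> (b : R[i]^o) -> a = b.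
Proof. by apply: cvg_unique; exact: norm_hausdorff. Qed.

(** Real and imaginary parts are each dominated by [M], so the real comparison test applies to both
    and the two sums recombine. *)
Lemma cvg_complex_series (d : nat -> R[i]) (M : R^nat) :
  (forall j, `|d j| <= (M j)%:C%C) -> cvgn (series M) ->
  cvgn (series d : nat -> R[i]^o).
Proof.
move=> dM cM.
have M0 j : 0 <= M j by rewrite -ler0c; apply: le_trans (dM j).
have cvgP (f : R[i] -> R) : (forall z, `|f z|%:C%C <= `|z|) ->
    cvgn (series (f \o d)).
  move=> fz; apply: normed_cvg; apply: series_le_cvg cM => [j|//|j] /=.
    exact: normr_ge0.
  by rewrite -lecR; apply: le_trans (dM j); exact: fz.
have /cvg_ex[a /cvg_real_complex ca] := cvgP _ (@normc_ge_Re R).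
have Imle z : `|complex.Im z|%:C%C <= `|z|.
  rewrite -normrN -ReiNIm; apply: le_trans (normc_ge_Re _) _.
  by rewrite normrM complexiE normCi mulr1.
have /cvg_ex[b /cvg_real_complex cb] := cvgP _ Imle.
apply/cvg_ex; exists (a%:C%C + 'i%C * b%:C%C).
rewrite [X in X @ _ --> _](_ : _ =
   (fun n => (series (@complex.Re R \o d) n)%:C%C +
    'i%C * (series (@complex.Im R \o d) n)%:C%C)); last first.
  apply/funext => n /=; rewrite /series /= !rmorph_sum mulr_sumr -big_split /=.
  by apply: eq_bigr => j _; rewrite -complexE.
have cib := cvg_complexMl (c := 'i%C) cb.
have cab := cvg_complexD ca cib.
exact: cab.
Qed.

(* Any bound B rho^j with rho > 1 would do: the coefficients come from power
   series of radius at least 1. *)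
Lemma pseries_tail (d : nat -> R[i]) (B : R) t (L : R[i]) n :
  (forall j, `|d j| <= (B * 2 ^+ j)%:C%C) -> `|t| <= (1 / 4)%:C%C ->
  (series (fun j => d j * t ^+ j) : nat -> R[i]^o) @ \oo --> (L : R[i]^o) ->
  `|L - \sum_(j < n) d j * t ^+ j| <= (2 * B * 2 ^+ n)%:C%C * `|t| ^+ n.
Proof.
move=> dB t4 cL.
have B0 : 0 <= B by have := le_trans (normr_ge0 _) (dB 0%N); rewrite expr0 mulr1 ler0c.
(* Since [2 |t| <= 1/2], the term of index n + m is at most B 2^n |t|^n 2^-m; the factor 1 - 2^-m
   records the partial geometric sum and makes the induction close. *)
have step m : `|\sum_(n <= j < n + m) d j * t ^+ j| <=
   (2 * B * 2 ^+ n)%:C%C * `|t| ^+ n * (1 - (2^-1) ^+ m)%:C%C.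
  elim: m => [|m IH].
    by rewrite addn0 big_geq// normr0 expr0 subrr mulr0.
  rewrite addnS big_nat_recr ?leq_addr//= (le_trans (ler_normD _ _))//.
  rewrite (le_trans (lerD IH (lexx _)))//.
  have -> : (1 - (2^-1) ^+ m.+1)%:C%C = (1 - (2^-1) ^+ m)%:C%C + (2^-1 ^+ m.+1)%:C%C :> R[i].
    rewrite -rmorphD /=; congr (_%:C%C); rewrite exprS; lra.
  rewrite mulrDr lerD2l normrM normrX.
  rewrite (le_trans (ler_wpM2r _ (dB _))) ?exprn_ge0// !exprD.
  have -> : (B * (2 ^+ n * 2 ^+ m))%:C%C * (`|t| ^+ n * `|t| ^+ m) =
    (B * 2 ^+ n)%:C%C * `|t| ^+ n * ((2 ^+ m)%:C%C * `|t| ^+ m) by rewrite mulrA rmorphM/=; ring.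
  have -> : (2 * B * 2 ^+ n)%:C%C * `|t| ^+ n * (2^-1 ^+ m.+1)%:C%C =
    (B * 2 ^+ n)%:C%C * `|t| ^+ n * (2^-1 ^+ m)%:C%C.
    rewrite exprS !rmorphM /= rmorphXn /=; by field.
  apply: ler_wpM2l.
    by rewrite mulr_ge0 ?exprn_ge0// ler0c mulr_ge0// exprn_ge0.
  apply: le_trans (ler_wpM2l _ (_ : `|t| ^+ m <= ((1 / 4) ^+ m)%:C%C)) _.
  - by rewrite ler0c exprn_ge0.
  - by rewrite rmorphXn lerXn2r// ?nnegrE ?ler0c// divr_ge0.
  - by rewrite -rmorphM /= lecR -exprMn (_ : 2 * (1 / 4) = 2^-1)//; lra.
apply: (@cvg_complex_norm_le (fun m => series (fun j => d j * t ^+ j) m - \sum_(j < n) d j * t ^+ j) _ _ n) => [|m nm].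
  exact: (cvg_complexD cL (@cvg_complex_cst _)).
rewrite /series /= (big_cat_nat (n := n))//= big_mkord addrAC subrr add0r.
rewrite -(subnKC nm) (le_trans (step _))//.
rewrite ler_piMr//; last by rewrite lecR gerBl exprn_ge0.
by rewrite mulr_ge0 ?exprn_ge0// ler0c !mulr_ge0// exprn_ge0.
Qed.

Definition disc_point z (z1 : `|z| < 1) : disc R :=
  exist (fun z : R[i] => is_true (`|z| < 1)) z z1.

Lemma real_disc_lt1 (x : R) : 0 <= x < 1 -> `|x%:C%C : R[i]| < 1.
Proof. by move=> /andP[x0 x1]; rewrite normc_real ltcR ger0_norm. Qed.

End ComplexSequences.

Arguments disc_point {R z} z1 /.

(** * The kernel as a power series in one variable *)

Section Kernel.
Variables (R : realType) (b : nat -> R).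
Hypothesis b_adm : admissible b.
Implicit Types (z w t : R[i]) (x : R).

Let b_gt0 j : 0 < b j. Proof. by have [_ /(_ j)] := b_adm. Qed.

Lemma admissible_cvg x : 0 <= x < 1 -> cvgn (pseries b x).
Proof.
move=> /andP[x0 x1]; have [_ _ r1] := b_adm.
have /ereal_sup_gt[_ [y cy <-]] : (x%:E < radius_of_convergence b)%E.
  by rewrite r1 lte_fin.
by rewrite lte_fin => xy; apply: is_cvg_pseries_inside cy _; rewrite ger0_norm.
Qed.

Lemma pseries_partial_le x n : 0 <= x < 1 ->
  \sum_(j < n) b j * x ^+ j <= limn (pseries b x).
Proof.
move=> x01; have := nondecreasing_cvgn_le _ (admissible_cvg x01) n.
rewrite /pseries /series /= big_mkord; apply.
apply/nondecreasing_seqP => m; rewrite big_nat_recr//= lerDl.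
by rewrite mulr_ge0 ?exprn_ge0 ?(ltW (b_gt0 _))//; case/andP: x01.
Qed.

(** The series converges at 1/2 and its terms are nonnegative, so each of them is at most the
    sum. *)
Lemma admissible_growth : exists2 B : R, 0 < B & forall j, b j <= B * 2 ^+ j.
Proof.
have h : 0 <= (1 / 2 : R) < 1 by lra.
exists (limn (pseries b (1 / 2))) => [|j].
  have := pseries_partial_le 1 h; apply: lt_le_trans.
  by rewrite big_ord1 expr0 mulr1.
have := pseries_partial_le j.+1 h; rewrite big_ord_recr/=.
have s0 : 0 <= \sum_(i < j) b i * (1 / 2) ^+ i.
  by apply: sumr_ge0 => i _; rewrite mulr_ge0 ?exprn_ge0 ?(ltW (b_gt0 _)).
move=> /(le_trans (lerD s0 (lexx _))); rewrite add0r => le.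
rewrite -[leLHS](mulfK (_ : 2 ^+ j != 0 :> R)) ?expf_neq0 ?pnatr_eq0//.
have -> : b j * 2 ^+ j / 2 ^+ j = b j * (1 / 2) ^+ j * 2 ^+ j.
  by rewrite expr_div_n expr1n mul1r mulrAC.
by rewrite ler_wpM2r// exprn_ge0.
Qed.

Definition kernel_series t : R[i] :=
  limn (series (fun j => (b j)%:C%C * t ^+ j : R[i]^o)).

Lemma ps_kernelE z w : ps_kernel b z w = kernel_series (w^* * z).
Proof. by []. Qed.

Lemma kernel_series_cvg t : `|t| < 1 ->
  (series (fun j => (b j)%:C%C * t ^+ j) : nat -> R[i]^o) @ \oo -->
  (kernel_series t : R[i]^o).
Proof.
have /ge0_complexP[x xt x0] := normr_ge0 t; rewrite xt ltcR => x1.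
apply: (@cvg_complex_series R _ (fun j => b j * x ^+ j)) => [j|].
  by rewrite normrM normrX xt normc_real ger0_norm ?(ltW (b_gt0 _))// rmorphM rmorphXn.
by apply: admissible_cvg; rewrite x0.
Qed.

Lemma kernel_series_real x : 0 <= x < 1 ->
  kernel_series x%:C%C = (limn (pseries b x))%:C%C.
Proof.
move=> x01; have /andP[x0 x1] := x01.
have h : `|x%:C%C : R[i]| < 1 by rewrite normc_real ger0_norm// ltcR.
apply: (cvg_complex_unique (kernel_series_cvg h)).
have := cvg_real_complex (admissible_cvg x01).
rewrite (_ : (fun _ => _) = (series (fun j => (b j)%:C%C * x%:C%C ^+ j)))//.
apply/funext => n; rewrite /pseries /series /= rmorph_sum.
by apply: eq_bigr => j _; rewrite rmorphM rmorphXn.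
Qed.

Lemma kernel_series_tail : exists2 B : R, 0 < B &
  forall t n, `|t| <= (1 / 4)%:C%C ->
  `|kernel_series t - \sum_(j < n) (b j)%:C%C * t ^+ j| <=
    (B * 2 ^+ n)%:C%C * `|t| ^+ n.
Proof.
have [B B0 bB] := admissible_growth; exists (2 * B) => [|t n t4].
  by rewrite mulr_gt0.
apply: (@pseries_tail R (fun j => (b j)%:C%C) B t) => [j|//|].
  by rewrite normc_real ger0_norm ?(ltW (b_gt0 _))// lecR.
apply: kernel_series_cvg; apply: le_lt_trans t4 _.
by rewrite ltcR; lra.
Qed.

End Kernel.

(** * The monomials of the Hilbert space *)

Section ReproducingKernelHilbertSpace.
Variables (R : realType) (X : Type) (k : X -> X -> R[i]) (H : rkhs k).
Implicit Types (f g u v : H).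

Local Notation "''[' u , v ]" := (rkhs_dot H u v).

Lemma rkhs_dotC u v : '[u, v] = '[v, u]^*.
Proof. by rewrite hermC expr0 mul1r. Qed.

Lemma rkhs_dotZl a u v : '[a *: u, v] = a * '[u, v].
Proof. exact: linearZl_LR. Qed.

Lemma rkhs_dotZr a u v : '[u, a *: v] = a^* * '[u, v].
Proof. exact: linearZr_LR. Qed.

Lemma rkhs_dotBl u v f : '[u - v, f] = '[u, f] - '[v, f].
Proof. exact: linearBl. Qed.

Lemma rkhs_dotBr f u v : '[f, u - v] = '[f, u] - '[f, v].
Proof. exact: linearBr. Qed.

Lemma rkhs_dot_suml I (r : seq I) (P : pred I) (F : I -> H) v :
  '[\sum_(i <- r | P i) F i, v] = \sum_(i <- r | P i) '[F i, v].
Proof. exact: linear_sumlz. Qed.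

Lemma rkhs_dot_sumr I (r : seq I) (P : pred I) (F : I -> H) v :
  '[v, \sum_(i <- r | P i) F i] = \sum_(i <- r | P i) '[v, F i].
Proof. exact: linear_sumr. Qed.

Lemma rkhs_cauchy_schwarz u v : `|'[u, v]| <= `|u| * `|v|.
Proof.
have [->|v0] := eqVneq v 0; first by rewrite linear0r !normr0 mulr0.
have n0 : 0 < '[v, v] by rewrite dnorm_gt0.
rewrite -(@ler_pXn2r _ 2) ?nnegrE ?mulr_ge0// exprMn !rkhs_norm_dot.
have : 0 <= '['[v, v] *: u - '[u, v] *: v, '[v, v] *: u - '[u, v] *: v].
  exact: dnorm_ge0.
rewrite rkhs_dotBl !rkhs_dotBr !rkhs_dotZl !rkhs_dotZr (rkhs_dotC v u).
rewrite (CrealP (ger0_real (ltW n0))) normCK.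
set c := '[u, v]; set n := '[v, v].
rewrite [X in 0 <= X](_ : _ = n * (n * '[u, u] - c * c^*)); last by ring.
by rewrite pmulr_rge0// subr_ge0 [n * _]mulrC.
Qed.

Lemma rkhs_dot_cvg (f_ : nat -> H) f g : f_ @ \oo --> f ->
  (fun n => '[f_ n, g] : R[i]^o) @ \oo --> ('[f, g] : R[i]^o).
Proof.
move=> /cvgrPdist_lt fc; apply/cvg_complexP => e e0.
have [x gx x0] := ge0_complexP (normr_ge0 g).
have d0 : 0 < (e / (x + 1))%:C%C :> R[i] by rewrite ltcR divr_gt0// ltr_wpDl.
have [N _ HN] := fc _ d0; exists N => n /HN /= h.
rewrite -rkhs_dotBl (le_lt_trans (rkhs_cauchy_schwarz _ _))// gx.
rewrite (@le_lt_trans _ _ (`|f - f_ n| * (x + 1)%:C%C))//.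
  by rewrite ler_wpM2l// lecR lerDl.
by rewrite -ltr_pdivlMr ?ltcR ?ltr_wpDl// -fmorphV -rmorphM.
Qed.

(** The record only asserts that such a vector exists; by injectivity of [rkhs_fun] it is unique,
    and the choice never falls back on its default. *)
Definition kernel_vector (w : X) : H :=
  xget 0 [set kw : H | rkhs_fun H kw = k^~ w].

Lemma kernel_vector_fun w : rkhs_fun H (kernel_vector w) = k^~ w.
Proof.
have [kw kwE _] := rkhs_reproducing H w.
by apply: (@xgetI _ 0 [set kw : H | rkhs_fun H kw = k^~ w] kw).
Qed.

Lemma kernel_vector_dot f w : '[f, kernel_vector w] = rkhs_fun H f w.
Proof.
have [kw kwE ->] := rkhs_reproducing H w; congr '[_, _].
by apply: (@rkhs_fun_inj _ _ _ H); rewrite kernel_vector_fun.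
Qed.

Lemma kernel_vector_gram z w : '[kernel_vector w, kernel_vector z] = k z w.
Proof. by rewrite kernel_vector_dot kernel_vector_fun. Qed.

End ReproducingKernelHilbertSpace.

(** * Orthogonality of the monomials and the Taylor expansion *)

Section Monomials.
Variables (R : realType) (b : nat -> R) (b_adm : admissible b).
Variable H : rkhs (@disc_kernel R b).
Implicit Types (f g u v : H) (z w : disc R).

Local Notation "''[' u , v ]" := (rkhs_dot H u v).

Let b_gt0 j : 0 < b j. Proof. by have [_ /(_ j)] := b_adm. Qed.

Let real_point_proof n : `|((n.+4%:R)^-1)%:C%C : R[i]| < 1.
Proof.
by rewrite normc_real ltcR ger0_norm ?invr_ge0// invf_lt1 ?ltr0n// ltr1n.
Qed.

(** These points tend to 0; starting at 1/4 keeps them in the range of [kernel_series_tail]. *)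
Let real_point n : disc R := disc_point (real_point_proof n).

(** That z^j belongs to the space is not part of the record; [monomialP] proves it, so the choice
    never falls back on its default. *)
Definition monomial j : H :=
  xget 0 [set e : H | rkhs_fun H e = fun z => sval z ^+ j].

(** Products are asked only with monomials of index at most j, which lets the statement be proved by
    strong induction. *)
Let monomial_spec j := rkhs_fun H (monomial j) = (fun z => sval z ^+ j) /\
  (forall l, (l <= j)%N -> '[monomial j, monomial l] = (l == j)%:R / (b j)%:C%C).

(* The normalized remainder of the kernel function at a point w tends to z^j
   as w tends to 0. *)
Lemma monomial_step j :
  (forall l, (l < j)%N -> monomial_spec l) -> monomial_spec j.
Proof.
move=> IH.
pose x n : R := (n.+4%:R)^-1.
have x0 n : 0 < x n by rewrite invr_gt0 ltr0n.
have xE n : sval (real_point n) = (x n)%:C%C by [].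
have conjR (y : R) : (y%:C%C : R[i])^* = y%:C%C.
  by apply: conj_Creal; apply/complex_realP; exists y.
have orth l l' : (l < j)%N -> (l' < j)%N ->
    '[monomial l, monomial l'] = (l == l')%:R / (b l)%:C%C.
  move=> lj l'j; have [ll'|/ltnW ll'] := leqP l' l.
    by have [_ /(_ _ ll') ->] := IH _ lj; rewrite eq_sym.
  rewrite rkhs_dotC; have [_ /(_ _ ll') ->] := IH _ l'j.
  have [->|] := eqVneq l l'; last by rewrite !mul0r conjC0.
  by rewrite !mul1r -fmorphV conjR.
(* The kernel vector at x_n minus its projection on the earlier monomials: what remains, as a
   function, starts with b_j x_n^j z^j. *)
pose u n := kernel_vector H (real_point n) -
  \sum_(l < j) (b l * x n ^+ l)%:C%C *: monomial l.
have U2 n l : (l < j)%N -> '[u n, monomial l] = 0.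
  move=> lj; rewrite rkhs_dotBl rkhs_dot_suml rkhs_dotC kernel_vector_dot.
  have [-> _] := IH _ lj; rewrite xE -rmorphXn conjR.
  rewrite (bigD1 (Ordinal lj))//= big1 => [|i /negP il].
    rewrite addr0 rkhs_dotZl orth// eqxx mul1r rmorphM/=.
    by rewrite mulrAC mulfV ?mul1r ?subrr// fmorph_eq0 gt_eqF.
  rewrite rkhs_dotZl orth//; case: eqP => [il'|]; last by rewrite mul0r mulr0.
  by case: il; apply/eqP/val_inj.
have U1 n z : '[u n, kernel_vector H z] =
    kernel_series b ((x n)%:C%C * sval z) -
    \sum_(l < j) (b l)%:C%C * ((x n)%:C%C * sval z) ^+ l.
  rewrite rkhs_dotBl kernel_vector_gram /disc_kernel ps_kernelE xE conjR.
  congr (_ - _); rewrite rkhs_dot_suml; apply: eq_bigr => l _.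
  rewrite rkhs_dotZl kernel_vector_dot; have [-> _] := IH _ (ltn_ord l).
  by rewrite exprMn mulrA rmorphM rmorphXn.
have U3 g n : (forall l, (l < j)%N -> '[g, monomial l] = 0) ->
    '[g, u n] = '[g, kernel_vector H (real_point n)].
  move=> gl; rewrite rkhs_dotBr rkhs_dot_sumr big1 ?subr0// => l _.
  by rewrite rkhs_dotZr gl// mulr0.
pose s n := ((b j * x n ^+ j)^-1)%:C%C : R[i].
pose f_ n := s n *: u n.
have s_inv n : s n * (b j)%:C%C * (x n)%:C%C ^+ j = 1.
  rewrite /s -mulrA -rmorphXn -!rmorphM/= mulVf// mulf_neq0 ?gt_eqF//.
  by rewrite exprn_gt0.
have s0 n : 0 <= s n.
  by rewrite ler0c invr_ge0 mulr_ge0 ?exprn_ge0// ltW.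
have F0 n l : (l < j)%N -> '[f_ n, monomial l] = 0.
  by move=> lj; rewrite rkhs_dotZl U2// mulr0.
have [B B0 tail] := kernel_series_tail b_adm.
(* The tail after degree j carries one more power of x_n, so it still tends to 0 after the
   normalization by [s n]. *)
have [C C0 F1] : exists2 C : R, 0 < C & forall n z,
    `|'[f_ n, kernel_vector H z] - sval z ^+ j| <=
    (C * x n)%:C%C * `|sval z| ^+ j.+1.
  exists (B * 2 ^+ j.+1 / b j) => [|n z].
    by rewrite divr_gt0 ?mulr_gt0 ?exprn_gt0.
  have xz : `|(x n)%:C%C * sval z| <= (1 / 4)%:C%C.
    rewrite normrM normc_real (ger0_norm (ltW (x0 _))).
    have z1 : `|sval z| < 1 by case: (z).
    have x0C : 0 <= (x n)%:C%C :> R[i] by rewrite ler0c ltW.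
    apply: le_trans (ler_wpM2l x0C (ltW z1)) _.
    by rewrite mulr1 lecR /x mul1r lef_pV2 ?posrE ?ltr0n// ler_nat.
  rewrite rkhs_dotZl U1.
  have -> : sval z ^+ j = s n * ((b j)%:C%C * ((x n)%:C%C * sval z) ^+ j).
    by rewrite exprMn !mulrA s_inv mul1r.
  rewrite -mulrBr -addrA -opprD.
  have := tail _ j.+1 xz; rewrite big_ord_recr /= => tl.
  rewrite normrM; apply: le_trans (ler_wpM2l (normr_ge0 _) tl) _.
  rewrite (ger0_norm (s0 n)) normrM exprMn normc_real (ger0_norm (ltW (x0 _))).
  have -> : (x n)%:C%C ^+ j.+1 = (x n ^+ j.+1)%:C%C :> R[i] by rewrite rmorphXn.
  rewrite !mulrA -!rmorphM/=; apply: ler_wpM2r; first by rewrite exprn_ge0.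
  rewrite lecR !exprS le_eqVlt; apply/orP; left; apply/eqP; field.
  by rewrite ?expf_neq0 ?gt_eqF.
(* As [f_ n] is orthogonal to the earlier monomials, its product with [f_ m] is [s m] times its
   value at x_m, which [F1] controls. *)
have F2 n m : `|'[f_ n, f_ m] - ((b j)^-1)%:C%C| <=
    (C / b j * x n * x m)%:C%C.
  rewrite rkhs_dotZr U3; last by move=> l /F0.
  have -> : ((b j)^-1)%:C%C = s m * (x m)%:C%C ^+ j :> R[i].
    have := s_inv m; rewrite mulrAC => /(canRL (mulfK _)) ->.
      by rewrite mul1r fmorphV.
    by rewrite fmorph_eq0 gt_eqF.
  rewrite conjR -mulrBr normrM -xE.
  apply: le_trans (ler_wpM2l (normr_ge0 _) (F1 _ _)) _.
  rewrite (ger0_norm (s0 m)) xE normc_real (ger0_norm (ltW (x0 _))).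
  have -> : (x m)%:C%C ^+ j.+1 = (x m ^+ j.+1)%:C%C :> R[i] by rewrite rmorphXn.
  rewrite -!rmorphM/= lecR.
  rewrite le_eqVlt; apply/orP; left; apply/eqP; rewrite !exprS; field.
  by rewrite ?expf_neq0 ?gt_eqF.
(* The four errors in the expanded square add up to (C / b_j) (x_n + x_m)^2, so the sequence is
   Cauchy. *)
have F3 n m : `|f_ n - f_ m| <= (Num.sqrt (C / b j) * (x n + x m))%:C%C.
  have h0 : 0 <= C / b j by rewrite divr_ge0 ?ltW.
  rewrite -(@ler_pXn2r _ 2) ?nnegrE//; last first.
    by rewrite ler0c mulr_ge0 ?sqrtr_ge0 ?addr_ge0 ?ltW.
  rewrite rkhs_norm_dot rkhs_dotBl !rkhs_dotBr.
  set c := ((b j)^-1)%:C%C in F2.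
  have -> : '[f_ n, f_ n] - '[f_ n, f_ m] - ('[f_ m, f_ n] - '[f_ m, f_ m]) =
    ('[f_ n, f_ n] - c) - ('[f_ n, f_ m] - c) - ('[f_ m, f_ n] - c) +
    ('[f_ m, f_ m] - c) by ring.
  rewrite -[leLHS]ger0_norm; last first.
    rewrite [X in 0 <= X](_ : _ = '[f_ n - f_ m, f_ n - f_ m]) ?dnorm_ge0//.
    by rewrite rkhs_dotBl !rkhs_dotBr; ring.
  apply: le_trans (ler_normD _ _) _.
  apply: le_trans (lerD (le_trans (ler_normB _ _)
    (lerD (le_trans (ler_normB _ _) (lerD (F2 _ _) (F2 _ _))) (F2 _ _))) (F2 _ _)) _.
  rewrite -rmorphXn -!rmorphD/= lecR exprMn sqr_sqrtr//.
  by rewrite le_eqVlt; apply/orP; left; apply/eqP; ring.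
have xN (e : R) : 0 < e -> exists N, forall n, (N <= n)%N -> x n < e.
  move=> e0; have [N _ HN] := near_infty_natSinv_lt (PosNum e0).
  exists N => n Nn; apply: le_lt_trans (HN _ Nn).
  by rewrite lef_pV2 ?posrE ?ltr0n// ler_nat; lia.
pose S := Num.sqrt (C / b j).
have S0 : 0 <= S by exact: sqrtr_ge0.
have [f fc] : exists f : H, f_ @ \oo --> f.
  suff cf : cauchy (f_ @ \oo).
    by exists (lim (f_ @ \oo)); exact: (@cauchy_cvg H (f_ @ \oo) _ cf).
  apply: cauchy_exP => _ /gt0_complexP[e -> e0].
  have S20 : 0 < 2 * (S + 1) by rewrite mulr_gt0// ltr_wpDl.
  have [N HN] := xN _ (divr_gt0 e0 S20).
  exists (f_ N); exists N => // n /= Nn.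
  rewrite -ball_normE /=; apply: le_lt_trans (F3 _ _) _; rewrite ltcR.
  have := HN _ Nn; have := HN _ (leqnn N).
  rewrite !ltr_pdivlMr// -/S => h1 h2.
  have := x0 N; have := x0 n; nra.
have f_fun : rkhs_fun H f = (fun z => sval z ^+ j).
  apply/funext => z; rewrite -kernel_vector_dot.
  apply: (cvg_complex_unique (rkhs_dot_cvg fc)); apply/cvg_complexP => e e0.
  have [N HN] := xN _ (divr_gt0 e0 C0); exists N => n /HN.
  rewrite ltr_pdivlMr// mulrC -ltcR distrC; apply: le_lt_trans.
  apply: le_trans (F1 _ _) _.
  have z1 : `|sval z| < 1 by case: (z).
  by rewrite ler_piMr ?ler0c ?mulr_ge0 ?(ltW C0) ?(ltW (x0 _))// exprn_ile1// ltW.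
have mf : monomial j = f.
  by apply: (@rkhs_fun_inj _ _ _ H); rewrite f_fun; apply: (@xgetI _ 0 [set e : H | rkhs_fun H e = fun z => sval z ^+ j] f).
have f_orth l : (l < j)%N -> '[f, monomial l] = 0.
  move=> lj; apply: (cvg_complex_unique (rkhs_dot_cvg fc)).
  apply/cvg_complexP => e e0; exists 0%N => n _.
  by rewrite F0// subrr normr0 ltcR.
split=> [|l]; first by rewrite mf f_fun.
rewrite leq_eqVlt => /orP[/eqP ->|lj]; last by rewrite mf f_orth// (ltn_eqF lj) mul0r.
rewrite eqxx mf.
(* For every n the product of [f_ n] with f is already 1 / b_j: it is [s n] times the conjugate of
   f(x_n) = x_n^j. *)
apply: (cvg_complex_unique (rkhs_dot_cvg fc)).
apply/cvg_complexP => e e0; exists 0%N => n _.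
rewrite rkhs_dotC rkhs_dotZr U3// kernel_vector_dot f_fun xE.
have sx : s n * (x n)%:C%C ^+ j = 1 / (b j)%:C%C.
  by rewrite -(s_inv n) mulrAC mulfK// fmorph_eq0 gt_eqF.
rewrite conjR sx mul1r -fmorphV conjR subrr normr0 ltcR//.
Qed.

Lemma monomialP j : monomial_spec j.
Proof.
suff /(_ j.+1 j (leqnn _)): forall n l, (l < n)%N -> monomial_spec l by [].
elim=> [//|n IH] l; rewrite ltnS => ln; apply: monomial_step => i il.
by apply: IH; exact: leq_trans ln.
Qed.

Lemma monomial_fun j : rkhs_fun H (monomial j) = (fun z => sval z ^+ j).
Proof. by have [] := monomialP j. Qed.

Lemma monomial_dot i j :
  '[monomial i, monomial j] = (i == j)%:R / (b j)%:C%C.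
Proof.
have bR n : ((b n)%:C%C : R[i])^* = (b n)%:C%C.
  by apply: conj_Creal; apply/complex_realP; exists (b n).
have [ji|/ltnW ij] := leqP j i.
  have [_ /(_ _ ji) ->] := monomialP i; rewrite eq_sym.
  by have [->|] := eqVneq i j; rewrite ?mul0r.
have [_ /(_ _ ij) h] := monomialP j; rewrite rkhs_dotC h.
by rewrite rmorphM fmorphV /= bR rmorph_nat.
Qed.

(** The orthogonal expansion coefficient, the squared norm of z^j being 1 / b_j; [coef_power_series]
    shows that it is the Taylor coefficient. *)
Definition coef f j : R[i] := (b j)%:C%C * '[f, monomial j].

Lemma kernel_vector_coef z j : coef (kernel_vector H z) j = (b j)%:C%C * (sval z)^* ^+ j.
Proof.
by rewrite /coef rkhs_dotC kernel_vector_dot monomial_fun rmorphXn.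
Qed.

(** The partial sums of the power series of f at z are the products of f with the partial sums [S]
    of the kernel vector. These converge in norm: the squared distance is the tail of the kernel
    series at |z|^2. *)
Lemma coef_power_series f : has_power_series (rkhs_fun H f) (coef f).
Proof.
move=> z.
pose S n := \sum_(j < n) ((b j)%:C%C * (sval z)^* ^+ j) *: monomial j.
have kR n : ((b n)%:C%C : R[i])^* = (b n)%:C%C.
  by apply: conj_Creal; apply/complex_realP; exists (b n).
have dS g n : '[g, S n] = series (fun j => coef g j * sval z ^+ j) n.
  rewrite rkhs_dot_sumr /series /= big_mkord; apply: eq_bigr => j _.
  by rewrite rkhs_dotZr rmorphM /= kR rmorphXn /= conjCK /coef mulrAC.
have z1 : `|sval z| < 1 by case: (z).
have zz1 : `|(sval z)^* * sval z| < 1.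
  by rewrite normrM norm_conjC mulr_ilt1.
have nS n : '[kernel_vector H z - S n, kernel_vector H z - S n] =
    kernel_series b ((sval z)^* * sval z) -
    series (fun j => (b j)%:C%C * ((sval z)^* * sval z) ^+ j) n.
  have Sm j : (j < n)%N -> '[S n, monomial j] = (sval z)^* ^+ j.
    move=> jn; rewrite rkhs_dot_suml (bigD1 (Ordinal jn))//= big1 => [|i /negP ij].
      rewrite addr0 rkhs_dotZl monomial_dot eqxx mul1r mulrAC mulfV ?mul1r//.
      by rewrite fmorph_eq0 gt_eqF.
    rewrite rkhs_dotZl monomial_dot; case: eqP => [e|]; last by rewrite mul0r mulr0.
    by case: ij; apply/eqP/val_inj.
  have SS : '[kernel_vector H z - S n, S n] = 0.
    rewrite [S n in X in '[_, X]]/S rkhs_dot_sumr big1// => j _.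
    rewrite rkhs_dotZr rkhs_dotBl Sm// rkhs_dotC kernel_vector_dot monomial_fun.
    by rewrite rmorphXn subrr mulr0.
  rewrite rkhs_dotBr SS subr0 rkhs_dotBl kernel_vector_gram.
  rewrite /disc_kernel ps_kernelE; congr (_ - _).
  rewrite rkhs_dotC dS /series /= rmorph_sum; apply: eq_bigr => j _.
  rewrite kernel_vector_coef !rmorphM /= kR !rmorphXn /= conjCK exprMn.
  by ring.
have Sc : S @ \oo --> kernel_vector H z.
  apply/cvgrPdist_lt => _ /gt0_complexP[e -> e0].
  have /cvg_complexP := kernel_series_cvg b_adm zz1.
  have e20 : 0 < e ^+ 2 by rewrite exprn_gt0.
  move=> /(_ _ e20)[N HN]; exists N => // n /= /HN.
  rewrite -nS ger0_norm ?dnorm_ge0// -rkhs_norm_dot rmorphXn.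
  by rewrite ltr_pXn2r// ?nnegrE// ler0c ltW.
have := rkhs_dot_cvg (g := f) Sc => Sf.
have -> : series (fun j => coef f j * sval z ^+ j) = (fun n => '[S n, f]^*).
  by apply/funext => n; rewrite -rkhs_dotC dS.
apply/cvg_complexP => e /(iffLR (cvg_complexP _ _) Sf)[N HN].
exists N => n Nn; rewrite -kernel_vector_dot rkhs_dotC.
by rewrite -(rmorphB (@conjC _)) norm_conjC; exact: HN.
Qed.

End Monomials.

(** * Bohr's inequality *)

Section RenewalSequence.
Variables (F : fieldType) (b : nat -> F).

(** When b_0 = 1 this solves b = 1 + c * b, a convolution of sequences; accumulating the earlier
    values in a list makes the recursion structural. *)
Fixpoint renewal_seq n : seq F :=
  if n is m.+1 then
    let s := renewal_seq m in
    rcons s (b m - (m == 0)%:R - \sum_(q < m) s`_q * b (m - q))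
  else [::].

Definition renewal n : F := (renewal_seq n.+1)`_n.

Lemma size_renewal_seq n : size (renewal_seq n) = n.
Proof. by elim: n => //= n IH; rewrite size_rcons IH. Qed.

Lemma nth_renewal_seq n i : (i < n)%N -> (renewal_seq n)`_i = renewal i.
Proof.
elim: n => // n IH; rewrite ltnS leq_eqVlt => /orP[/eqP ->//|lt_in].
by rewrite /= nth_rcons size_renewal_seq lt_in IH.
Qed.

Lemma renewal_eq n : renewal n = b n - (n == 0)%:R - \sum_(q < n) renewal q * b (n - q).
Proof.
rewrite /renewal /= nth_rcons size_renewal_seq ltnn eqxx.
by congr (_ - _); apply: eq_bigr => q _; rewrite nth_renewal_seq.
Qed.

Hypothesis b0 : b 0%N = 1.

Lemma renewal0 : renewal 0 = 0.
Proof. by rewrite renewal_eq big_ord0 b0 eqxx subrr subr0. Qed.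

Lemma renewalE n : b n = (n == 0)%:R + \sum_(q < n.+1) renewal q * b (n - q).
Proof. by rewrite big_ord_recr /= subnn b0 mulr1 renewal_eq; ring. Qed.

(** Substitute the convolution for b_p and put p = m + l; each induction step adds one diagonal of
    constant m + l. *)
Lemma renewal_sum (V : nat -> F) N : (0 < N)%N ->
  \sum_(p < N) b p * V p = V 0%N +
    \sum_(m < N) renewal m * \sum_(l < (N - m)%N) b l * V (m + l)%N.
Proof.
case: N => // N _; elim: N => [|N IH].
  by rewrite !big_ord1 b0 mul1r renewal0 mul0r addr0.
rewrite big_ord_recr /= {}IH renewalE add0r -addrA; congr (_ + _).
rewrite mulr_suml [X in _ + X = _]big_ord_recr [in RHS]big_ord_recr /= addrA; congr (_ + _); last first.
  by rewrite subSnn big_ord1 addn0 subnn b0 mul1r mulr1.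
rewrite -big_split; apply: eq_bigr => m _ /=.
have mN : (m <= N.+1)%N by apply: ltnW.
rewrite -mulrA -mulrDr; congr (_ * _).
rewrite [in RHS]subSn// big_ord_recr /=.
by rewrite subnKC.
Qed.

End RenewalSequence.

(** * The majorant bound from nonnegativity of the defect form *)

Section BohrInequality.
Variables (C : numClosedFieldType) (b c a : nat -> C) (M r : C).
Implicit Types (xi eta : nat -> C) (t x y : C) (N m l : nat).

Definition backshift l xi i := xi (l + i)%N.

Definition pairing N xi := \sum_(i < N) xi i * a i.

Definition defect N xi eta :=
  M ^+ 2 * (xi 0%N * (eta 0%N)^*) - pairing N xi * (pairing N eta)^*.

(* The form of M^2 - T T^* in the orthogonal basis b_j z^j, T being
   multiplication by the function with Taylor coefficients a. *)
Definition defect_form N xi eta :=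
  \sum_(l < N) b l * defect (N - l) (backshift l xi) (backshift l eta).

Definition comb x xi y eta i := x * xi i + y * eta i.

Definition unit0 i : C := (i == 0%N)%:R.

Lemma pairing_comb N x xi y eta :
  pairing N (comb x xi y eta) = x * pairing N xi + y * pairing N eta.
Proof.
rewrite /pairing !mulr_sumr -big_split; apply: eq_bigr => i _ /=.
by rewrite /comb; ring.
Qed.

Lemma defect_form_comb N x xi y eta :
  defect_form N (comb x xi y eta) (comb x xi y eta) =
  x * x^* * defect_form N xi xi + x * y^* * defect_form N xi eta +
  y * x^* * defect_form N eta xi + y * y^* * defect_form N eta eta.
Proof.
rewrite /defect_form !mulr_sumr -!big_split; apply: eq_bigr => l _ /=.
have -> : backshift l (comb x xi y eta) = comb x (backshift l xi) y (backshift l eta) by [].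
rewrite /defect pairing_comb /comb !rmorphD !rmorphM.
by ring.
Qed.

Hypotheses (b0 : b 0%N = 1) (b_ge0 : forall j, 0 <= b j).
Hypotheses (c_ge0 : forall m, 0 <= c m) (c0 : c 0%N = 0).
Hypothesis b_renewal : forall (V : nat -> C) N, (0 < N)%N ->
  \sum_(p < N) b p * V p = V 0%N +
    \sum_(m < N) c m * \sum_(l < (N - m)%N) b l * V (m + l)%N.
Hypothesis psd : forall N xi, 0 <= defect_form N xi xi.
Hypotheses (r_ge0 : 0 <= r) (c_small : forall N, 9 * \sum_(m < N) c m * r ^+ (2 * m) <= 1).
Hypothesis a0_lt : `|a 0%N| < M.

Let p2 := M ^+ 2 - `|a 0%N| ^+ 2.

Let M_gt0 : 0 < M. Proof. exact: le_lt_trans a0_lt. Qed.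

Let p2_gt0 : 0 < p2.
Proof. by rewrite subr_gt0 ltrXn2r ?nnegrE// ltW. Qed.

Lemma defect_formC N xi eta : defect_form N eta xi = (defect_form N xi eta)^*.
Proof.
rewrite /defect_form rmorph_sum; apply: eq_bigr => l _.
rewrite /defect !(rmorphM, rmorphB, rmorphXn) /= !conjCK.
rewrite (CrealP (ger0_real (b_ge0 l))) (CrealP (ger0_real (ltW M_gt0))).
by congr (_ * _); ring.
Qed.

(** [b_renewal] is applied to the defects of the shifts of xi: the inner sum of index m is the form
    at the m-th shift, with the length cut to N - m. *)
Lemma defect_form_rec N xi : (0 < N)%N -> defect_form N xi xi =
  defect N xi xi + \sum_(m < N) c m * defect_form (N - m) (backshift m xi) (backshift m xi).
Proof.
move=> N0; rewrite /defect_form.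
rewrite (b_renewal (fun l => defect (N - l) (backshift l xi) (backshift l xi)) N0) subn0.
congr (_ + _); apply: eq_bigr => m _; congr (_ * _); apply: eq_bigr => l _.
rewrite subnDA /backshift; congr (_ * defect _ _ _); apply/boolp.funext => i /=; by rewrite addnA.
Qed.

Lemma defect_form_unit0r N xi : (0 < N)%N ->
  defect_form N xi unit0 = M ^+ 2 * xi 0%N - pairing N xi * (a 0%N)^*.
Proof.
case: N => // N _; rewrite /defect_form big_ord_recl big1 => [|l _]; last first.
  have z n : pairing n (backshift (lift ord0 l) unit0) = 0.
    by rewrite /pairing big1// => i _; rewrite /backshift /unit0 /= mul0r.
  by rewrite /defect z /backshift /unit0 /= conjC0 !mulr0 subrr mulr0.
rewrite b0 mul1r addr0 subn0 /defect /backshift /= {2}/pairing big_ord_recl big1 => [|i _].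
  by rewrite /unit0 /= addr0 mul1r conjC1 mulr1.
by rewrite /unit0 /= mul0r.
Qed.

Lemma defect_form_unit0 N : (0 < N)%N -> defect_form N unit0 unit0 = p2.
Proof.
move=> N0; rewrite defect_form_unit0r// /p2 normCK; congr (_ - _ * _).
  by rewrite mulr1.
case: N N0 => // N _; rewrite /pairing big_ord_recl big1 => [|i _].
  by rewrite mul1r addr0.
by rewrite /unit0 mul0r.
Qed.

(** The difference of the two sides is the form at xi - 2 eta. With these weights the bounds in
    [shift_sum_le] add up to the 9 of [c_small]. *)
Lemma defect_form_parallelogram N xi eta : 
  2 * defect_form N (comb 1 xi 1 eta) (comb 1 xi 1 eta) <= 3 * defect_form N xi xi + 6 * defect_form N eta eta.
Proof.
rewrite -subr_ge0; have := psd N (comb 1 xi (-2) eta).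
rewrite !defect_form_comb !(rmorphN, rmorph1, rmorph_nat) /=.
by congr (0 <= _); ring.
Qed.

(* Induction on N: the shifts of xi split as xi_m e_0 plus a vector of the same
   kind scaled by r^m. *)
Lemma shift_sum_le N xi t : (forall N', (N' < N)%N -> forall xi t, 0 <= t ->
    xi 0%N = 0 -> (forall i, `|xi i| <= t * r ^+ i) ->
    4 * defect_form N' xi xi <= t ^+ 2 * p2) ->
  0 <= t -> (forall i, `|xi i| <= t * r ^+ i) ->
  4 * (\sum_(m < N) c m * defect_form (N - m) (backshift m xi) (backshift m xi)) <=
    t ^+ 2 * p2.
Proof.
move=> IH t0 xir.
have step (m : 'I_N) : c m * (4 * defect_form (N - m) (backshift m xi) (backshift m xi)) <=
    c m * (9 * (t ^+ 2 * r ^+ (2 * m) * p2)).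
  have [m0|m0] := posnP m; first by rewrite m0 c0 !mul0r.
  apply: ler_wpM2l => //.
  pose v i := if i == 0%N then 0 else xi (m + i)%N.
  (* [comb] takes two vectors, so the multiple of [unit0] by xi_m is padded with a zero multiple. *)
  have -> : backshift m xi = comb 1 (comb (xi m) unit0 0 unit0) 1 v.
    apply/boolp.funext => -[|i]; rewrite /comb /v /backshift /unit0 /=.
      by rewrite addn0; ring.
    by ring.
  have Nm : (0 < N - m)%N by rewrite subn_gt0.
  have Nm' : (N - m < N)%N by have := ltn_ord m; lia.
  have hv : 4 * defect_form (N - m) v v <= (t * r ^+ m) ^+ 2 * p2.
    apply: IH => // [|[|i]]; first by rewrite mulr_ge0 ?exprn_ge0.
      by rewrite /v /= normr0 !mulr_ge0 ?exprn_ge0.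
    by rewrite /v /= -mulrA -exprD.
  have hu : defect_form (N - m) (comb (xi m) unit0 0 unit0) (comb (xi m) unit0 0 unit0) <=
     (t * r ^+ m) ^+ 2 * p2.
    rewrite defect_form_comb !(conjC0, mulr0, mul0r, addr0) defect_form_unit0// -normCK.
    by rewrite ler_wpM2r ?(ltW p2_gt0)// lerXn2r ?nnegrE// mulr_ge0 ?exprn_ge0.
  have := defect_form_parallelogram (N - m) (comb (xi m) unit0 0 unit0) v => /= par.
  set Q := defect_form _ (comb 1 _ 1 _) _ in par *.
  have -> : 4 * Q = 2 * (2 * Q) by ring.
  apply: le_trans (ler_wpM2l _ par) _ => //.
  (* In units of (t r^m)^2 p2 the part along [unit0] contributes 6, and the part v contributes 12
     times a quarter, hence 9 in all. *)
  rewrite mulrDr; apply: le_trans (lerD (ler_wpM2l _ (ler_wpM2l _ hu)) (_ : _ <= 3 * ((t * r ^+ m) ^+ 2 * p2))) _ => //.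
    have -> : 2 * (6 * defect_form (N - m) v v) =
        3 * (4 * defect_form (N - m) v v) by ring.
    by rewrite ler_wpM2l.
  rewrite exprMn -exprM [(m * 2)%N]mulnC le_eqVlt; apply/orP; left; apply/eqP; ring.
rewrite mulr_sumr (eq_bigr (fun m : 'I_N => c m * (4 * defect_form (N - m) (backshift m xi) (backshift m xi)))); last first.
  by move=> m _; ring.
apply: (@le_trans _ _ (\sum_(m < N) c m * (9 * (t ^+ 2 * r ^+ (2 * m) * p2)))).
  by apply: ler_sum => m _; exact: step.
rewrite (eq_bigr (fun m : 'I_N => t ^+ 2 * p2 * (9 * (c m * r ^+ (2 * m))))); last first.
  by move=> m _; ring.
rewrite -mulr_sumr -mulr_sumr ler_piMr//.
  by rewrite mulr_ge0 ?exprn_ge0 ?(ltW p2_gt0).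
exact: c_small.
Qed.

Lemma defect_diag N xi : xi 0%N = 0 -> defect N xi xi = - `|pairing N xi| ^+ 2.
Proof. by move=> xi0; rewrite /defect xi0 mul0r mulr0 sub0r normCK. Qed.

(** With xi_0 = 0 the defect of xi itself is nonpositive, so the recursion leaves only the sum over
    the shifts. *)
Lemma defect_form_le N xi t : 0 <= t -> xi 0%N = 0 ->
  (forall i, `|xi i| <= t * r ^+ i) -> 4 * defect_form N xi xi <= t ^+ 2 * p2.
Proof.
elim/ltn_ind: N xi t => N IH xi t t0 xi0 xir.
have [->|N0] := posnP N.
  by rewrite /defect_form big_ord0 mulr0 mulr_ge0 ?exprn_ge0// ltW.
apply: le_trans (shift_sum_le IH t0 xir).
by rewrite defect_form_rec// defect_diag// ler_wpM2l// gerDr oppr_le0 exprn_ge0.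
Qed.

Lemma pairing_le N xi : xi 0%N = 0 -> (forall i, `|xi i| <= r ^+ i) ->
  2 * M * `|pairing N xi| <= p2.
Proof.
move=> xi0 xir.
have [->|N0] := posnP N.
  by rewrite /pairing big_ord0 normr0 mulr0 ltW.
(* The same recursion, now keeping the nonpositive term that [defect_form_le] drops. *)
have le1 : 4 * `|pairing N xi| ^+ 2 + 4 * defect_form N xi xi <= p2.
  rewrite defect_form_rec// defect_diag// -mulrDr addrA subrr add0r.
  rewrite -[leRHS]mul1r -[X in X * p2](expr1n _ 2).
  apply: shift_sum_le => // [N' _|i]; first exact: defect_form_le.
  by rewrite mul1r.
pose k := defect_form N xi unit0.
have kE : k = - (pairing N xi * (a 0%N)^*).
  by rewrite /k defect_form_unit0r// xi0 mulr0 sub0r.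
(* Cauchy-Schwarz for the form, from its nonnegativity at p2 xi - k e_0. *)
have cs : `|k| ^+ 2 <= p2 * defect_form N xi xi.
  have := psd N (comb p2 xi (- k) unit0).
  rewrite defect_form_comb defect_form_unit0// (defect_formC N xi unit0) -/k.
  rewrite rmorphN (CrealP (ger0_real (ltW p2_gt0))).
  rewrite [X in 0 <= X](_ : _ = p2 * (p2 * defect_form N xi xi - `|k| ^+ 2)).
    by rewrite pmulr_rge0// subr_ge0.
  by rewrite normCK; ring.
rewrite -(@ler_pXn2r _ 2) ?nnegrE ?(ltW p2_gt0)//; last first.
  by rewrite !mulr_ge0// ltW.
(* Uses p2 + |a_0|^2 = M^2 to merge the two estimates into one square. *)
have -> : (2 * M * `|pairing N xi|) ^+ 2 =
    p2 * (4 * `|pairing N xi| ^+ 2) + 4 * `|k| ^+ 2.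
  by rewrite kE normrN normrM norm_conjC /p2; ring.
apply: le_trans (lerD (lexx _) (ler_wpM2l _ cs)) _ => //.
have -> : p2 * (4 * `|pairing N xi| ^+ 2) + 4 * (p2 * defect_form N xi xi) =
    p2 * (4 * `|pairing N xi| ^+ 2 + 4 * defect_form N xi xi) by ring.
by rewrite [leRHS]expr2 ler_wpM2l// ltW.
Qed.

Theorem bohr_inequality N : \sum_(j < N) `|a j| * r ^+ j <= M.
Proof.
case: N => [|N]; first by rewrite big_ord0 ltW.
(* The phases turn each product xi_i a_i with i > 0 into |a_i| r^i; where a_i = 0 the quotient is 0
   by convention. *)
pose xi i := if i == 0%N then 0 else r ^+ i * ((a i)^* / `|a i|).
have xir i : `|xi i| <= r ^+ i.
  rewrite /xi; case: eqP => _; first by rewrite normr0 exprn_ge0.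
  rewrite normrM (ger0_norm (exprn_ge0 _ _))// ler_piMr ?exprn_ge0//.
  rewrite normrM normfV norm_conjC normr_id.
  have [->|ai0] := eqVneq (a i) 0; first by rewrite normr0 mul0r.
  by rewrite mulfV// normr_eq0.
have := @pairing_le N.+1 xi erefl xir.
have -> : pairing N.+1 xi = \sum_(j < N) `|a j.+1| * r ^+ j.+1.
  rewrite /pairing big_ord_recl mul0r add0r; apply: eq_bigr => i _.
  rewrite /xi /= /bump /= add1n [LHS]mulrC mulrCA mulrC; congr (_ * _).
  have [->|ai0] := eqVneq (a i.+1) 0; first by rewrite normr0 mul0r.
  by rewrite mulrA -normCK expr2 mulfK// normr_eq0.
rewrite big_ord_recl expr0 mulr1 ger0_norm; last first.
  by apply: sumr_ge0 => i _; rewrite mulr_ge0 ?exprn_ge0.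
under [in X in _ -> X]eq_bigr do rewrite /= /bump /= add1n.
set T := (X in _ * X) => h.
rewrite -lerBrDl -(ler_pM2l (_ : 0 < 2 * M)) ?mulr_gt0//.
(* p2 = (M - |a_0|) (M + |a_0|), and M + |a_0| <= 2 M. *)
apply: le_trans h _; rewrite /p2 subr_sqr mulrC ler_wpM2r ?subr_ge0 ?(ltW a0_lt)//.
by rewrite [2 * M]mulr_natl mulr2n lerD2l ltW.
Qed.

End BohrInequality.

(** * Multipliers *)

Section PowerSeriesUniqueness.
Variable R : realType.
Implicit Types (a : nat -> R[i]) (z : disc R) (phi : disc R -> R[i]).

Lemma small_real_point (e : R) : 0 < e ->
  exists2 x : R, 0 < x <= 1 / 4 & x < e.
Proof.
move=> e0; exists (Num.min (1 / 4) (e / 2)).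
  by rewrite lt_min ge_min lexx !divr_gt0.
by rewrite gt_min (_ : e / 2 < e) ?orbT//; lra.
Qed.

(** Convergence at 1/2 bounds |a_n| by B 2^n. If the earlier coefficients vanish, [pseries_tail]
    gives |a_n| x^n <= D x^(n+1) for all small x > 0, hence a_n = 0. *)
Lemma power_series_eq0 a : has_power_series (fun=> 0) a -> forall n, a n = 0.
Proof.
move=> a0.
have h : 0 <= (1 / 2 : R) < 1 by lra.
have /cvg_complexP/(_ _ ltr01)[N HN] := a0 (disc_point (real_disc_lt1 h)).
pose t n := `|a n| * (1 / 2)%:C%C ^+ n.
have t0 n : 0 <= t n by rewrite mulr_ge0// exprn_ge0// ler0c; lra.
have tN n : (N <= n)%N -> t n <= 2.
  move=> Nn; have := HN _ Nn; have := HN _ (leqW Nn).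
  rewrite !sub0r !normrN /series /= big_nat_recr//= => h1 h2.
  have -> : t n = `|a n * (1 / 2)%:C%C ^+ n|.
    rewrite normrM normrX; congr (_ * _ ^+ _).
    by rewrite normc_real ger0_norm//; lra.
  rewrite -[X in `|X|](addKr (\sum_(0 <= j < n) a j * (1 / 2)%:C%C ^+ j)).
  apply: le_trans (ler_normD _ _) _; rewrite normrN.
  by rewrite (_ : 2 = 1 + 1) ?lerD ?ltW//; ring.
have [B aB] : exists B : R, forall n, `|a n| <= (B * 2 ^+ n)%:C%C.
  have : 0 <= 2 + \sum_(i < N) t i by rewrite addr_ge0// sumr_ge0.
  move=> /ge0_complexP[B BE B0]; exists B => n.
  have tB : t n <= B%:C%C.
    rewrite -BE; have [nN|nN] := ltnP n N.
      by rewrite (bigD1 (Ordinal nN))//= addrCA lerDl addr_ge0// sumr_ge0.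
    by rewrite (le_trans (tN _ nN))// lerDl sumr_ge0.
  have -> : `|a n| = t n * (2 ^+ n)%:C%C.
    rewrite /t -mulrA rmorphXn -exprMn -rmorphM /= (_ : 1 / 2 * 2 = 1) ?expr1n ?mulr1//.
    by lra.
  by rewrite rmorphM ler_wpM2r// ler0c exprn_ge0.
elim/ltn_ind => n IH.
apply/eqP; apply: contraT => an0.
have /gt0_complexP[e ee e0] : 0 < `|a n| by rewrite normr_gt0.
have B0 : 0 <= B by have := le_trans (normr_ge0 _) (aB 0%N); rewrite expr0 mulr1 ler0c.
pose D := 2 * B * 2 ^+ n.+1.
have D0 : 0 < D + 1 by rewrite ltr_wpDl// !mulr_ge0// exprn_ge0.
have [x /andP[x0 x4] xe] := small_real_point (divr_gt0 e0 D0).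
have x01 : 0 <= x < 1 by lra.
have x4' : `|x%:C%C : R[i]| <= (1 / 4)%:C%C by rewrite normc_real gtr0_norm// lecR.
have := pseries_tail n.+1 aB x4' (a0 (disc_point (real_disc_lt1 x01))).
rewrite big_ord_recr /= big1 => [|i _]; last by rewrite IH// mul0r.
rewrite sub0r normrN add0r normrM normrX normc_real (gtr0_norm x0) [x%:C%C ^+ n.+1]exprS mulrA.
rewrite ler_pM2r ?exprn_gt0 ?ltcR// -rmorphM ee lecR -/D => le.
move: xe; rewrite ltr_pdivlMr// mulrDr mulr1 => xe; exfalso.
by nra.
Qed.

Lemma power_series_unique phi a a' :
  has_power_series phi a -> has_power_series phi a' -> a = a'.
Proof.
move=> pa pa'; apply/funext => n; apply/eqP; rewrite -subr_eq0; apply/eqP.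
apply: (@power_series_eq0 (fun j => a j - a' j)) => z.
have := cvg_complexD (pa z) (cvg_complexMl (c := -1) (pa' z)).
rewrite mulN1r subrr => c0; rewrite (_ : series _ = (fun n =>
  series (fun j => a j * sval z ^+ j) n +
  -1 * series (fun j => a' j * sval z ^+ j) n))//.
apply/funext => m; rewrite /series /= mulN1r -sumrB.
by apply: eq_bigr => j _; rewrite mulrBl.
Qed.

Lemma power_series_shift phi a m : has_power_series phi a ->
  has_power_series (fun z => sval z ^+ m * phi z)
    (fun n => if (m <= n)%N then a (n - m)%N else 0).
Proof.
move=> pa z; have /cvg_complexP cz := cvg_complexMl (c := sval z ^+ m) (pa z).
apply/cvg_complexP => e /cz[N HN]; exists (m + N)%N => n mNn.
have mn : (m <= n)%N by apply: leq_trans mNn; rewrite leq_addr.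
have {}/HN : (N <= n - m)%N by rewrite leq_subRL.
rewrite /series /= => lt_e; rewrite [X in _ - X](_ : _ =
  sval z ^+ m * \sum_(0 <= j < (n - m)%N) a j * sval z ^+ j)//.
rewrite (big_cat_nat (n := m))//= big1_seq => [|i]; last first.
  by rewrite mem_index_iota => /andP[_ /andP[_ im]]; rewrite leqNgt im mul0r.
rewrite add0r -{1}[m]add0n big_addn mulr_sumr; apply: eq_bigr => j _.
by rewrite leq_addl addnK exprD; ring.
Qed.

End PowerSeriesUniqueness.

(** * The multiplier norm and positivity of the defect form *)

Section Multipliers.
Variables (R : realType) (b : nat -> R) (b_adm : admissible b).
Variable H : rkhs (@disc_kernel R b).
Implicit Types (f g : H) (z : disc R) (phi : disc R -> R[i]) (a : nat -> R[i]).

Local Notation "''[' u , v ]" := (rkhs_dot H u v).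
Local Notation monomial := (monomial H).

Let b_gt0 j : 0 < b j. Proof. by have [_ /(_ j)] := b_adm. Qed.

Lemma coef_unique f a : has_power_series (rkhs_fun H f) a -> a = coef f.
Proof. by move=> /power_series_unique; apply; exact: coef_power_series. Qed.

Lemma coef_sum n (x : 'I_n -> R[i]) (g : 'I_n -> H) i :
  coef (\sum_j x j *: g j) i = \sum_j x j * coef (g j) i.
Proof.
rewrite /coef rkhs_dot_suml mulr_sumr; apply: eq_bigr => j _.
by rewrite rkhs_dotZl mulrCA.
Qed.

Lemma mul_graph_sum phi n (x : 'I_n -> R[i]) (f g : 'I_n -> H) :
  (forall j, mul_graph phi (f j) (g j)) ->
  mul_graph phi (\sum_j x j *: f j) (\sum_j x j *: g j).
Proof.
move=> fg; rewrite /mul_graph !linear_sum; apply/funext => z /=.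
rewrite !fct_sumE mulr_sumr; apply: eq_bigr => j _.
by rewrite !linearZ /= fg /GRing.scale /= mulrCA.
Qed.

Lemma multiplier_fun phi : is_multiplier H phi -> exists g, rkhs_fun H g = phi.
Proof.
move=> [/(_ (monomial 0))[g gE] _]; exists g; rewrite gE.
by apply/funext => z /=; rewrite monomial_fun// expr0 mulr1.
Qed.

Lemma taylor_coefP phi : is_multiplier H phi ->
  has_power_series phi (taylor_coef phi).
Proof.
move=> /multiplier_fun[g <-].
apply: (@xgetPex _ (fun=> 0) [set a | has_power_series (rkhs_fun H g) a]).
by exists (coef g); exact: coef_power_series.
Qed.

Lemma mul_monomial_coef phi a m g n :
  has_power_series phi a -> mul_graph phi (monomial m) g ->
  coef g n = if (m <= n)%N then a (n - m)%N else 0.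
Proof.
move=> pa gE.
suff /(congr1 (fun c => c n)) /= <- :
  (fun n => if (m <= n)%N then a (n - m)%N else 0) = coef g by [].
apply: coef_unique; rewrite gE (monomial_fun b_adm).
have -> : phi \* (fun z => sval z ^+ m) = (fun z => sval z ^+ m * phi z).
  by apply/funext => z; rewrite /= mulrC.
exact: power_series_shift.
Qed.

Lemma mult_norm_le phi c : mul_bound H phi c -> mult_norm H phi <= c.
Proof.
move=> bc; apply: ge_inf => //; exists 0 => x [].
by [].
Qed.

(** The infimum is attained: for f nonzero, |g| / |f| is a lower bound of all admissible constants.
    For f = 0 any one bound forces g = 0. *)
Lemma mult_norm_bound phi : is_multiplier H phi ->
  mul_bound H phi (mult_norm H phi).
Proof.
move=> [_ [c0 c0b]].
have ne : [set c | mul_bound H phi c] !=set0 by exists c0.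
split=> [|f g fg]; first by apply: lb_le_inf => // x [].
have [x fx x0] := ge0_complexP (normr_ge0 f).
have [y gy y0] := ge0_complexP (normr_ge0 g).
rewrite fx gy -rmorphM lecR.
have [x00|xn0] := eqVneq x 0.
  have [_ /(_ _ _ fg)] := c0b; rewrite fx gy x00 -rmorphM lecR mulr0 => y0'.
  by rewrite mulr0.
have xp : 0 < x by rewrite lt_neqAle eq_sym xn0.
rewrite -ler_pdivrMr//; apply: lb_le_inf => // c [_ /(_ _ _ fg)].
by rewrite fx gy -rmorphM lecR ler_pdivrMr.
Qed.

Lemma rkhs_norm_ortho n (x : 'I_n -> R[i]) :
  `|\sum_(j < n) x j *: monomial j| ^+ 2 =
  \sum_(j < n) `|x j| ^+ 2 / (b j)%:C%C.
Proof.
rewrite rkhs_norm_dot rkhs_dot_suml; apply: eq_bigr => i _.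
rewrite rkhs_dot_sumr (bigD1 i)//= big1 => [|j /negP ij].
  by rewrite addr0 rkhs_dotZl rkhs_dotZr monomial_dot// eqxx mul1r mulrA normCK.
rewrite rkhs_dotZl rkhs_dotZr monomial_dot//; case: eqP => [e|].
  by case: ij; apply/eqP/val_inj.
by rewrite mul0r !mulr0.
Qed.

(** With f = sum b_i conj(xi_i) z^i, the vector h is the adjoint of multiplication by phi applied to
    f, written out by coefficients. As the product of phi h with f is |h|^2, Cauchy-Schwarz gives
    |h| <= M |f|, and the form is M^2 |f|^2 - |h|^2. *)
Lemma mult_defect_ge0 phi a M N xi : is_multiplier H phi -> mul_bound H phi M ->
  has_power_series phi a ->
  0 <= defect_form (fun j => (b j)%:C%C) a M%:C%C N xi xi.
Proof.
move=> [phiM _] [M0 phib] pa.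
pose T l := pairing a (N - l) (backshift l xi).
have TE (l : 'I_N) : T l = \sum_(i < N) xi i * (if (l <= i)%N then a (i - l)%N else 0).
  rewrite -(big_mkord xpredT (fun i => xi i * (if (l <= i)%N then a (i - l)%N else 0))).
  rewrite (big_cat_nat (n := l))//= ?(ltnW (ltn_ord l))// big1_seq => [|i]; last first.
    by rewrite mem_index_iota => /andP[_ /andP[_ il]]; rewrite leqNgt il mulr0.
  rewrite add0r -{1}[X in index_iota X]add0n big_addn big_mkord.
  by apply: eq_bigr => i _; rewrite leq_addl addnK /backshift addnC.
pose bC j := (b j)%:C%C : R[i].
pose f := \sum_(i < N) (bC i * (xi i)^*) *: monomial i.
pose h := \sum_(l < N) (bC l * (T l)^*) *: monomial l.
have [g_ g_E] := choice (fun l => phiM (monomial l)).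
pose g := \sum_(l < N) (bC l * (T l)^*) *: g_ l.
have hg : mul_graph phi h g by apply: (@mul_graph_sum phi N _ (fun l : 'I_N => monomial l) (fun l : 'I_N => g_ l)) => l; exact: g_E.
have bCR n : (bC n)^* = bC n by apply: conj_Creal; apply/complex_realP; exists (b n).
have bC0 n : 0 < bC n by rewrite ltcR.
have normE (x : nat -> R[i]) : `|\sum_(l < N) (bC l * (x l)^*) *: monomial l| ^+ 2 =
   \sum_(l < N) bC l * `|x l| ^+ 2.
  rewrite rkhs_norm_ortho; apply: eq_bigr => l _.
  rewrite normrM norm_conjC (ger0_norm (ltW (bC0 l))) exprMn -/(bC l).
  by field; rewrite (gt_eqF (bC0 _)).
have gf : '[g, f] = `|h| ^+ 2.
  rewrite normE rkhs_dot_sumr.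
  rewrite (eq_bigr (fun i : 'I_N => \sum_(l < N) bC l * (T l)^* * (xi i * (if (l <= i)%N then a (i - l)%N else 0)))); last first.
    move=> i _; rewrite rkhs_dotZr rmorphM /= conjCK bCR.
    have gi := coef_sum (fun l : 'I_N => bC l * (T l)^*) (fun l : 'I_N => g_ l) i.
    rewrite /coef -/(bC i) -/g in gi.
    rewrite [bC i * _]mulrC -mulrA gi mulr_sumr.
    apply: eq_bigr => l _; have := mul_monomial_coef i pa (g_E l).
    by rewrite /coef -/(bC i) => ->; rewrite mulrCA.
  rewrite exchange_big /=; apply: eq_bigr => l _.
  by rewrite -mulr_sumr -TE normCK; ring.
have hf : `|h| <= M%:C%C * `|f|.
  have [->|h0] := eqVneq h 0; first by rewrite normr0 mulr_ge0// ler0c.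
  rewrite -(@ler_pM2l _ `|h|) ?normr_gt0// -expr2 -[leLHS]ger0_norm ?exprn_ge0// -gf.
  apply: le_trans (rkhs_cauchy_schwarz _ _) _.
  by rewrite mulrA [`|h| * _]mulrC ler_wpM2r// phib.
have : `|h| ^+ 2 <= (M%:C%C * `|f|) ^+ 2.
  by rewrite lerXn2r ?nnegrE// mulr_ge0// ler0c.
rewrite exprMn /h /f !normE -subr_ge0 mulr_sumr -sumrB /defect_form.
congr (0 <= _); apply: eq_bigr => l _.
by rewrite /defect -!normCK /backshift addn0 -/(bC l) -/(T l); ring.
Qed.

End Multipliers.

(** * The complete Pick property *)

Section RootsOfUnity.
Variable C : numClosedFieldType.

(** X^n - 1 splits and is separable, hence has n distinct roots, and n distinct n-th roots of unity
    include a primitive one. *)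
Lemma prim_root_exists n : (0 < n)%N -> exists w : C, n.-primitive_root w.
Proof.
move=> n0; have [r rE] := closed_field_poly_normal ('X^n - 1 : {poly C}).
rewrite (monicP (monicXnsubC _ n0)) scale1r in rE.
have r1 : all n.-unity_root r.
  by apply/allP => z; rewrite -root_prod_XsubC -rE.
have sr : (n <= size r)%N.
  by rewrite -ltnS -(size_prod_XsubC r id) -rE size_XnsubC.
have ur : uniq r.
  rewrite -separable_prod_XsubC -rE; apply: separable_Xn_sub_1.
  by rewrite pnatr_eq0 -lt0n.
by have /hasP[w _ wP] := cyclic.has_prim_root n0 r1 ur sr; exists w.
Qed.

Variables (n : nat) (w : C).
Hypothesis w_prim : n.-primitive_root w.

Let n_gt0 : (0 < n)%N. Proof. exact: prim_order_gt0 w_prim. Qed.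

Lemma norm_prim_root : `|w| = 1.
Proof.
apply/eqP; rewrite -(@pexpr_eq1 _ _ n)// -normrX prim_expr_order//.
by rewrite normr1.
Qed.

(** A geometric sum whose ratio x satisfies x^n = 1, with x = 1 only when p = q. *)
Lemma prim_root_orthogonality p q : (p < n)%N -> (q < n)%N ->
  \sum_(i < n) w ^+ (i * p) * (w ^+ (i * q))^* = (p == q)%:R * n%:R.
Proof.
move=> pn qn.
have wq : w ^+ q * (w ^+ q)^* = 1 by rewrite -normCK normrX norm_prim_root !expr1n.
pose x := w ^+ p * (w ^+ q)^*.
rewrite (eq_bigr (fun i : 'I_n => x ^+ i)); last first.
  by move=> i _; rewrite /x exprMn -rmorphXn -!exprM ![(_ * i)%N]mulnC.
case: eqP => [pq|/eqP pq].
  rewrite mul1r (eq_bigr (fun=> 1)) ?sumr_const ?card_ord// => i _.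
  by rewrite /x pq wq expr1n.
have xn : x ^+ n = 1.
  rewrite exprMn -(rmorphXn (@conjC C)) -!exprM ![(_ * n)%N]mulnC !exprM (prim_expr_order w_prim).
  by rewrite !expr1n rmorph1 mulr1.
have x1 : x - 1 != 0.
  rewrite subr_eq0; apply: contra pq => /eqP x1.
  have : w ^+ p = w ^+ q by rewrite -[LHS]mulr1 -wq mulrCA -/x x1 mulr1.
  by move/eqP; rewrite (eq_prim_root_expr w_prim) !modn_small.
rewrite mul0r; apply/eqP.
have := subrX1 x n; rewrite xn subrr => /esym/eqP.
by rewrite mulf_eq0 (negPf x1).
Qed.

Lemma prim_root_parseval (v : 'I_n -> C) :
  \sum_(l < n) `|\sum_(i < n) v i * w ^+ (i * l)| ^+ 2 =
  n%:R * \sum_(i < n) `|v i| ^+ 2.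
Proof.
under eq_bigr => l _.
  rewrite normCK rmorph_sum mulr_suml.
  under eq_bigr => i _ do rewrite mulr_sumr.
  over.
rewrite exchange_big mulr_sumr; apply: eq_bigr => i _ /=.
rewrite exchange_big /= (bigD1 i)//= [X in _ + X]big1 => [|j ji].
  rewrite addr0 (eq_bigr (fun=> `|v i| ^+ 2)) ?sumr_const ?card_ord ?mulr_natl// => l _.
  by rewrite -normCK normrM normrX norm_prim_root expr1n mulr1.
rewrite (eq_bigr (fun l : 'I_n => v i * (v j)^* * (w ^+ (l * i) * (w ^+ (l * j))^*))).
  rewrite -mulr_sumr prim_root_orthogonality// (inj_eq val_inj) eq_sym (negPf ji).
  by rewrite mul0r mulr0.
by move=> l _; rewrite rmorphM /= ![(l * _)%N]mulnC; ring.
Qed.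

End RootsOfUnity.

Lemma horner_tail (C : numClosedFieldType) (p : {poly C}) N : exists2 K : C, 0 <= K &
  forall t, `|t| <= 1 -> `|p.[t] - \sum_(l < N) p`_l * t ^+ l| <= K * `|t| ^+ N.
Proof.
exists (\sum_(i < size p) `|p`_(N + i)|) => [|t t1]; first exact: sumr_ge0.
rewrite (@horner_coef_wide _ (N + size p)) ?leq_addl// big_split_ord /=.
rewrite addrAC subrr add0r mulr_suml; apply: le_trans (ler_norm_sum _ _ _) _.
apply: ler_sum => i _; rewrite normrM ler_wpM2l// normrX exprD.
by rewrite ler_piMr ?exprn_ge0// exprn_ile1.
Qed.

(** * Pick matrices of row interpolation problems *)

Section CirclePick.
Variables (R : realType) (b : nat -> R) (b_adm : admissible b).
Variable H : rkhs (@disc_kernel R b).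
Implicit Types (f g : H) (z : disc R).

Local Notation "''[' u , v ]" := (rkhs_dot H u v).
Local Notation k := (@disc_kernel R b).
Local Notation c := (renewal b).

Let b_gt0 j : 0 < b j. Proof. by have [_ /(_ j)] := b_adm. Qed.
Let b0 : b 0%N = 1. Proof. by have [] := b_adm. Qed.

Lemma kernelC z w : k w z = (k z w)^*.
Proof.
rewrite -(kernel_vector_gram H w z) -(kernel_vector_gram H z w).
exact: rkhs_dotC.
Qed.

Lemma kernel_psd n (x : 'I_n -> disc R) (v : 'I_n -> R[i]) :
  0 <= \sum_i \sum_j (v i)^* * v j * k (x i) (x j).
Proof.
pose f := \sum_i v i *: kernel_vector H (x i).
suff -> : \sum_i \sum_j (v i)^* * v j * k (x i) (x j) = '[f, f].
  by rewrite dnorm_ge0.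
rewrite rkhs_dot_sumr; apply: eq_bigr => i _; rewrite rkhs_dot_suml.
apply: eq_bigr => j _; rewrite rkhs_dotZl rkhs_dotZr.
by rewrite (kernel_vector_gram H (x i) (x j)); ring.
Qed.

(** [complete_pick] is stated for square matrices, so the row is completed by zero rows. The form
    then splits: component 0 carries the Pick form of the row, every other component the plain
    kernel form. *)
Lemma pick_row_psd n s (x : 'I_n -> disc R) (r : 'I_n -> 'I_s.+1 -> R[i]) :
  (forall v : 'I_n -> R[i], 0 <= \sum_i \sum_j (v i)^* * v j *
     (k (x i) (x j) * (1 - \sum_q r i q * (r j q)^*))) ->
  let W i := \matrix_(p, q) ((p == 0)%:R * r i q) : 'M[R[i]]_s.+1 in
  psdmx (\mxblock_(i < n, j < n)
             (k (x i) (x j) *: (1%:M - W i *m (W j) ^t*))).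
Proof.
move=> rP W v; rewrite -[v]submxcolK.
set u := submxcol v.
have -> : (\mxcol_i u i) ^t* = \mxrow_i (u i) ^t*.
  by apply/matrixP => i j; rewrite !mxE.
rewrite mul_mxrow_mxblock mul_mxrow_mxcol summxE.
pose G i j := \sum_q r i q * (r j q)^*.
have WW i j p q : (W i *m (W j) ^t*) p q = (p == 0)%:R * (q == 0)%:R * G i j.
  rewrite mxE /G mulr_sumr; apply: eq_bigr => l _; rewrite !mxE rmorphM rmorph_nat.
  by ring.
have ME i j p q : (k (x i) (x j) *: (1%:M - W i *m (W j) ^t*)) p q =
    k (x i) (x j) * ((p == q)%:R - (p == 0)%:R * (q == 0)%:R * G i j).
  rewrite mxE; congr (_ * _); rewrite mxE; congr (_ + _); first by rewrite mxE.
  by rewrite mxE WW.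
have sum1 (F : 'I_s.+1 -> R[i]) q : \sum_p (p == q)%:R * F p = F q.
  by rewrite (bigD1 q)//= eqxx mul1r big1 ?addr0// => p /negPf ->; rewrite mul0r.
have E j : ((\sum_i (u i) ^t* *m (k (x i) (x j) *: (1%:M - W i *m (W j) ^t*))) *m u j) 0 0 =
   \sum_i (\sum_q (u i q 0)^* * u j q 0 * k (x i) (x j) -
   (u i 0 0)^* * u j 0 0 * k (x i) (x j) * G i j).
  rewrite mulmx_suml summxE; apply: eq_bigr => i _.
  rewrite mxE.
  have -> : (u i 0 0)^* * u j 0 0 * k (x i) (x j) * G i j = \sum_q (q == 0)%:R *
      ((u i 0 0)^* * u j q 0 * k (x i) (x j) * G i j) by rewrite sum1.
  rewrite -sumrB; apply: eq_bigr => q _.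
  have -> : (u i q 0)^* * u j q 0 * k (x i) (x j) = \sum_p (p == q)%:R *
      ((u i p 0)^* * u j q 0 * k (x i) (x j)) by rewrite sum1.
  have -> : (u i 0 0)^* * u j q 0 * k (x i) (x j) * G i j = \sum_p (p == 0)%:R *
      ((u i p 0)^* * u j q 0 * k (x i) (x j) * G i j) by rewrite sum1.
  rewrite mulr_sumr -sumrB mxE mulr_suml; apply: eq_bigr => p _.
  by rewrite ME !mxE; ring.
rewrite (eq_bigr _ (fun j _ => E j)).
rewrite (eq_bigr (fun j => \sum_i \sum_(q | q != 0) (u i q 0)^* * u j q 0 * k (x i) (x j) +
  \sum_i (u i 0 0)^* * u j 0 0 * (k (x i) (x j) * (1 - G i j)))); last first.
  move=> j _; rewrite -big_split; apply: eq_bigr => i _ /=.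
  by rewrite (bigD1 0)//=; ring.
rewrite big_split /= addr_ge0//; last by rewrite exchange_big; exact: rP.
under eq_bigr do rewrite exchange_big.
rewrite exchange_big sumr_ge0// => q _ /=.
by rewrite exchange_big; exact: (kernel_psd x (fun i => u i q 0)).
Qed.

End CirclePick.

(** * Positivity of the Pick matrix on small circles *)

Section CirclePositivity.
Variables (R : realType) (b : nat -> R) (b_adm : admissible b).
Variable H : rkhs (@disc_kernel R b).
Implicit Types (t z : R[i]).

Local Notation k := (@disc_kernel R b).
Local Notation c := (renewal b).

Let b_gt0 j : 0 < b j. Proof. by have [_ /(_ j)] := b_adm. Qed.
Let b0 : b 0%N = 1. Proof. by have [] := b_adm. Qed.

(* For l < N, the coefficient of t^l in
   (1 - theta sum_(q < N) c_q t^q) sum_j b_j t^j. *)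
Definition damped theta l : R := (1 - theta) * b l + theta * (l == 0%N)%:R.

(** For the truncation P of the kernel series, the renewal identity shows that the coefficients of
    (1 - G) P below degree N are [damped]. The error comes from the kernel tail and from the higher
    coefficients of this product. *)
Lemma damped_kernel_tail theta N : 0 < theta < 1 -> exists2 K : R, 0 < K &
  forall t, `|t| <= (1 / 4)%:C%C ->
  `|kernel_series b t * (1 - \sum_(q < N) (theta * c q)%:C%C * t ^+ q) -
    \sum_(l < N) (damped theta l)%:C%C * t ^+ l| <= K%:C%C * `|t| ^+ N.
Proof.
move=> /andP[th0 th1].
pose P : {poly R[i]} := \poly_(l < N) (b l)%:C%C.
pose G : {poly R[i]} := \poly_(q < N) (theta * c q)%:C%C.
have [B B0 tail] := kernel_series_tail b_adm.
have [K1 K10 tail1] := horner_tail (1 - G) 0.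
have [K2 K20 tail2] := horner_tail (P - G * P) N.
have BN0 : 0 <= (B * 2 ^+ N)%:C%C :> R[i].
  by rewrite ler0c mulr_ge0 ?exprn_ge0// ltW.
have [K3 K3E K30] := ge0_complexP (addr_ge0 (mulr_ge0 BN0 K10) K20).
exists (K3 + 1) => [|t t4]; first by rewrite ltr_wpDl.
have t1 : `|t| <= 1 by rewrite (le_trans t4)// lecR; lra.
have PE : P.[t] = \sum_(l < N) (b l)%:C%C * t ^+ l by rewrite horner_poly.
have GE : (1 - G).[t] = 1 - \sum_(q < N) (theta * c q)%:C%C * t ^+ q.
  by rewrite hornerD hornerN hornerC horner_poly.
have DE : \sum_(l < N) (damped theta l)%:C%C * t ^+ l =
    \sum_(l < N) (P - G * P)`_l * t ^+ l.
  apply: eq_bigr => l _; congr (_ * _); rewrite coefB coefM coef_poly ltn_ord.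
  rewrite (eq_bigr (fun q : 'I_l.+1 => (theta * (c q * b (l - q)))%:C%C)); last first.
    move=> q _; rewrite !coef_poly.
    have qN : (q < N)%N by apply: leq_ltn_trans (ltn_ord l); rewrite -ltnS.
    have lqN : (l - q < N)%N by apply: leq_ltn_trans (ltn_ord l); rewrite leq_subr.
    by rewrite qN lqN -rmorphM /= mulrA.
  rewrite -rmorph_sum -rmorphB /=; congr (_%:C%C).
  rewrite -mulr_sumr /damped {1 2}(renewalE b0 l).
  by set s := \sum_(_ < _) _; ring.
rewrite -GE DE.
have -> : kernel_series b t * (1 - G).[t] - \sum_(l < N) (P - G * P)`_l * t ^+ l =
  (kernel_series b t - P.[t]) * (1 - G).[t] +
  ((P - G * P).[t] - \sum_(l < N) (P - G * P)`_l * t ^+ l).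
  by rewrite !(hornerD, hornerN, hornerM, hornerC); ring.
apply: le_trans (ler_normD _ _) _.
rewrite rmorphD /= -K3E; apply: (@le_trans _ _
  ((B * 2 ^+ N)%:C%C * `|t| ^+ N * K1 + K2 * `|t| ^+ N)).
  apply: lerD; last exact: tail2.
  rewrite normrM ler_pM// ?PE; first exact: tail.
  by have := tail1 _ t1; rewrite big_ord0 subr0 expr0 mulr1.
rewrite [leRHS](_ : _ = (B * 2 ^+ N)%:C%C * `|t| ^+ N * K1 + K2 * `|t| ^+ N + `|t| ^+ N).
  by rewrite lerDl exprn_ge0.
by rewrite rmorph1; ring.
Qed.

Lemma min_coef N : exists2 m : R, 0 < m & forall l, (l < N)%N -> m <= b l.
Proof.
elim: N => [|N [m m0 mb]]; first by exists 1.
exists (Num.min m (b N)) => [|l]; first by rewrite lt_min m0 b_gt0.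
rewrite ltnS leq_eqVlt => /orP[/eqP ->|lN]; first by rewrite ge_min lexx orbT.
by rewrite ge_min mb.
Qed.

(** The damped polynomial contributes a sum of squares, at least m' e^(2(N-1)) N |v|^2 by Parseval,
    where m' > 0 because theta < 1. The rest is at most K e^(2N) N |v|^2, which is no larger once e
    is below 1/4 and m' / K. *)
Lemma circle_psd N w theta : N.-primitive_root w -> 0 < theta < 1 ->
  exists2 e0 : R, 0 < e0 <= 1 / 4 &
  forall (e : R) (x : 'I_N -> disc R), 0 < e <= e0 ->
  (forall i, sval (x i) = e%:C%C * w ^+ i) ->
  forall v : 'I_N -> R[i], 0 <= \sum_i \sum_j (v i)^* * v j *
     (k (x i) (x j) * (1 - \sum_(q < N) (theta * c q)%:C%C *
        ((sval (x j))^* * sval (x i)) ^+ q)).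
Proof.
move=> wP th01; have /andP[th0 th1] := th01.
have [K K0 tail] := damped_kernel_tail N th01.
have [m m0 mb] := min_coef N.
pose m' := (1 - theta) * m.
have m'0 : 0 < m' by rewrite mulr_gt0// subr_gt0.
exists (Num.min (1 / 4) (m' / K)).
  by rewrite lt_min ge_min lexx divr_gt0//= divr_gt0.
move=> e x /andP[e0]; rewrite le_min => /andP[e4 eK] xE v.
have N0 : (0 < N)%N by exact: prim_order_gt0 wP.
pose t i j := (sval (x j))^* * sval (x i).
have xn i : `|sval (x i)| = e%:C%C.
  by rewrite xE normrM normrX (norm_prim_root wP) expr1n mulr1 normc_real gtr0_norm.
have tn i j : `|t i j| = (e ^+ 2)%:C%C.
  by rewrite normrM norm_conjC !xn -rmorphM.
have t4 i j : `|t i j| <= (1 / 4)%:C%C by rewrite tn lecR; nra.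
pose E i j := k (x i) (x j) * (1 - \sum_(q < N) (theta * c q)%:C%C * t i j ^+ q) -
   \sum_(l < N) (damped theta l)%:C%C * t i j ^+ l.
have En i j : `|E i j| <= (K * e ^+ 2 ^+ N)%:C%C.
  apply: le_trans (tail _ (t4 i j)) _; rewrite tn.
  have -> : (K * e ^+ 2 ^+ N)%:C%C = K%:C%C * (e ^+ 2)%:C%C ^+ N :> R[i]
    by rewrite rmorphM rmorphXn.
  exact: lexx.
set S := \sum_i _.
pose V := \sum_i `|v i| ^+ 2.
pose main := \sum_(l < N) (damped theta l)%:C%C * `|\sum_i (v i)^* * sval (x i) ^+ l| ^+ 2.
have mainE : main = \sum_i \sum_j (v i)^* * v j *
    \sum_(l < N) (damped theta l)%:C%C * t i j ^+ l.
  under [RHS]eq_bigr do under eq_bigr do rewrite mulr_sumr.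
  under [RHS]eq_bigr do rewrite exchange_big.
  rewrite [RHS]exchange_big; apply: eq_bigr => l _ /=.
  rewrite normCK rmorph_sum mulr_suml mulr_sumr; apply: eq_bigr => i _.
  rewrite mulr_sumr mulr_sumr; apply: eq_bigr => j _.
  by rewrite rmorphM rmorphXn /= conjCK /t exprMn; ring.
have SE : S - main = \sum_i \sum_j (v i)^* * v j * E i j.
  rewrite mainE -sumrB; apply: eq_bigr => i _; rewrite -sumrB.
  by apply: eq_bigr => j _; rewrite -mulrBr.
(* A bound on |S - main| bounds S from below only once S is known to be real; this is Hermitian
   symmetry. *)
have Sr : S \is Num.real.
  apply/CrealP; rewrite /S rmorph_sum exchange_big; apply: eq_bigr => i _ /=.
  rewrite rmorph_sum; apply: eq_bigr => j _ /=.
  rewrite !rmorphM rmorphB rmorph1 rmorph_sum /= conjCK -(kernelC H).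
  rewrite [v i * _]mulrC; congr (_ * (_ * (1 - _))); apply: eq_bigr => q _.
  rewrite rmorphM rmorphXn rmorphM /= conjCK [sval (x j) * _]mulrC; congr (_ * _).
  by apply: conj_Creal; apply/complex_realP; exists (theta * c q).
have V0 : 0 <= V by apply: sumr_ge0 => i _; rewrite exprn_ge0.
have VN : \sum_i \sum_j `|v i| * `|v j| <= N%:R * V.
  have -> : N%:R * V = \sum_(i < N) \sum_(j < N) (`|v i| ^+ 2 / 2 + `|v j| ^+ 2 / 2).
    under eq_bigr do rewrite big_split /= sumr_const card_ord -mulr_suml -/V.
    rewrite big_split /= sumr_const card_ord sumrMnl -mulr_suml -/V.
    by rewrite -mulrnDl -splitr mulr_natl.
  apply: ler_sum => i _; apply: ler_sum => j _; rewrite -subr_ge0.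
  rewrite [X in 0 <= X](_ : _ = (`|v i| - `|v j|) ^+ 2 / 2); last by field.
  have r : `|v i| - `|v j| \is Num.real by apply: realB; exact: normr_real.
  by rewrite divr_ge0// -(real_normK r) exprn_ge0.
have errle : `|S - main| <= (K * e ^+ 2 ^+ N)%:C%C * (N%:R * V).
  rewrite SE; apply: le_trans (ler_norm_sum _ _ _) _.
  apply: (@le_trans _ _ ((K * e ^+ 2 ^+ N)%:C%C * \sum_i \sum_j `|v i| * `|v j|)); last first.
    by rewrite ler_wpM2l// ler0c mulr_ge0 ?exprn_ge0 ?ltW.
  rewrite mulr_sumr; apply: ler_sum => i _; apply: le_trans (ler_norm_sum _ _ _) _.
  rewrite mulr_sumr; apply: ler_sum => j _; rewrite !normrM norm_conjC mulrC.
  by rewrite ler_wpM2r ?mulr_ge0.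
have mainge : (m' * e ^+ 2 ^+ N.-1)%:C%C * (N%:R * V) <= main.
  have -> : V = \sum_(i < N) `|(v i)^*| ^+ 2.
    by apply: eq_bigr => i _; rewrite norm_conjC.
  rewrite -(prim_root_parseval wP) mulr_sumr; apply: ler_sum => l _.
  have -> : \sum_i (v i)^* * sval (x i) ^+ l =
      (e ^+ l)%:C%C * \sum_i (v i)^* * w ^+ (i * l).
    rewrite mulr_sumr; apply: eq_bigr => i _.
    by rewrite xE exprMn -exprM (rmorphXn (real_complex R)) /=; ring.
  rewrite normrM [X in _ <= _ * X]exprMn [leRHS]mulrA; apply: ler_wpM2r; first by rewrite exprn_ge0.
  rewrite normc_real (ger0_norm (exprn_ge0 _ (ltW e0))).
  have -> : (e ^+ l)%:C%C ^+ 2 = (e ^+ l ^+ 2)%:C%C :> R[i] by rewrite [RHS]rmorphXn.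
  rewrite -rmorphM /= lecR.
  apply: ler_pM; rewrite ?exprn_ge0 ?(ltW m'0) ?(ltW e0)//.
    apply: (@le_trans _ _ ((1 - theta) * b l)).
      by rewrite ler_wpM2l ?mb// subr_ge0 ltW.
    by rewrite /damped lerDl mulr_ge0// ltW.
  rewrite -!exprM mulnC; apply: ler_wiXn2l; first exact: ltW.
    by apply: le_trans e4 _; lra.
  by rewrite leq_mul2r /= -ltnS prednK.
have mainr : main \is Num.real.
  rewrite ger0_real// sumr_ge0// => l _; rewrite mulr_ge0 ?exprn_ge0// ler0c.
  by rewrite addr_ge0// mulr_ge0// ?subr_ge0 ltW.
apply: le_trans (real_ler_distlCBl (realB Sr mainr) errle).
rewrite subr_ge0; apply: le_trans mainge.
rewrite ler_wpM2r ?mulr_ge0// lecR -(prednK N0) exprS mulrA.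
rewrite ler_wpM2r ?exprn_ge0 ?(ltW e0)//.
rewrite ler_pdivlMr// in eK.
nra.
Qed.

End CirclePositivity.

Lemma sqr_lower_bound (R : realFieldType) (g a d : R) :
  0 <= g -> 0 <= a -> 0 <= d -> g - a <= d -> g ^+ 2 - 2 * g * d <= a ^+ 2.
Proof.
move=> g0 a0 d0 gd; have [dg|gd'] := lerP d g; nra.
Qed.

(** * Nonnegativity of the renewal coefficients *)

Section CompletePick.
Variables (R : realType) (b : nat -> R) (b_adm : admissible b).
Variable H : rkhs (@disc_kernel R b).
Implicit Types (f g : H) (z : disc R).

Local Notation "''[' u , v ]" := (rkhs_dot H u v).
Local Notation c := (renewal b).

Let b_gt0 j : 0 < b j. Proof. by have [_ /(_ j)] := b_adm. Qed.
Let b0 : b 0%N = 1. Proof. by have [] := b_adm. Qed.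

(** Contractivity bounds the whole product column; row p is one of its components, and the others
    exist because all entries are multipliers. *)
Lemma mx_mul_row s (Phi : disc R -> 'M[R[i]]_s) p (f g : 'I_s -> H) :
  mx_mul_contractive H Phi -> (forall p q, is_multiplier H (fun z => Phi z p q)) ->
  (forall q, mul_graph (fun z => Phi z p q) (f q) (g q)) ->
  `|\sum_q g q| ^+ 2 <= \sum_q `|f q| ^+ 2.
Proof.
move=> Phi1 PhiM fg.
have [G GE] := choice (fun pq : 'I_s * 'I_s => (PhiM pq.1 pq.2).1 (f pq.2)).
apply: le_trans (Phi1 f (fun r => \sum_q G (r, q)) _); last first.
  move=> r; rewrite linear_sum; apply/funext => z /=; rewrite fct_sumE.
  by apply: eq_bigr => q _; rewrite GE.
have -> : \sum_q g q = \sum_q G (p, q).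
  apply: eq_bigr => q _; apply: (@rkhs_fun_inj _ _ _ H).
  by rewrite (GE (p, q)) (fg q).
by rewrite [leRHS](bigD1 p)//= lerDl sumr_ge0// => r _; rewrite exprn_ge0.
Qed.

Lemma coef_norm_le f j : `|coef f j| ^+ 2 <= (b j)%:C%C * `|f| ^+ 2.
Proof.
have bj : 0 < (b j)%:C%C :> R[i] by rewrite ltcR.
rewrite /coef normrM exprMn (gtr0_norm bj).
have := rkhs_cauchy_schwarz f (monomial H j).
rewrite -(@ler_pXn2r _ 2) ?nnegrE ?mulr_ge0// exprMn [X in _ * X]rkhs_norm_dot.
rewrite (monomial_dot b_adm) eqxx mul1r => h.
apply: le_trans (ler_wpM2l (exprn_ge0 _ (ltW bj)) h) _.
by rewrite le_eqVlt; apply/orP; left; apply/eqP; field; rewrite (gt_eqF bj).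
Qed.

Lemma monomial_norm j : `|monomial H j| ^+ 2 = (b j)%:C%C^-1.
Proof. by rewrite rkhs_norm_dot (monomial_dot b_adm) eqxx mul1r. Qed.

Hypothesis H_pick : complete_pick H.

(** K depends neither on theta nor on e, so e can tend to 0 with theta fixed; the terms in K e
    account for the distance from the coefficients of the interpolant to sqrt(theta c_q). *)
Lemma pick_on_circle N : exists2 K : R, 0 < K &
  forall theta, 0 < theta < 1 -> (forall q, (q < N.+1)%N -> 0 <= c q) ->
  exists2 e0 : R, 0 < e0 & forall e, 0 < e <= e0 ->
  \sum_(q < N.+1) (theta * c q - 2 * Num.sqrt (theta * c q) * K * e) * b (N.+1 - q)
    <= b N.+1.
Proof.
have [B B0 bB] := admissible_growth b_adm.
exists (2 * (B + 1) * 2 ^+ N.+1) => [|theta th01 c_ge0].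
  by rewrite !mulr_gt0 ?exprn_gt0// addr_gt0.
have [w wP] := prim_root_exists R[i] (ltn0Sn N).
have [e0 /andP[e00 e04] psd] := circle_psd b_adm H wP th01.
exists e0 => // e /andP[epos ee0].
have e4 : e <= 1 / 4 by apply: le_trans ee0 e04.
have en i : `|e%:C%C * w ^+ i| = e%:C%C.
  by rewrite normrM normrX (norm_prim_root wP) expr1n mulr1 normc_real gtr0_norm.
have x1 i : `|e%:C%C * w ^+ i| < 1 by rewrite en ltcR; lra.
pose x (i : 'I_N.+1) : disc R := disc_point (x1 i).
pose ga q := Num.sqrt (theta * c q).
have thc q : (q < N.+1)%N -> 0 <= theta * c q.
  by move=> qN; rewrite mulr_ge0 ?c_ge0//; case/andP: th01 => /ltW.
pose r (i q : 'I_N.+1) := (ga q)%:C%C * sval (x i) ^+ q.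
have gaR q : ((ga q)%:C%C : R[i])^* = (ga q)%:C%C.
  by apply: conj_Creal; apply/complex_realP; exists (ga q).
have rE i q : (r i q)^* = (ga q)%:C%C * (sval (x i))^* ^+ q.
  by rewrite -(gaR q) -(rmorphXn (@conjC _)) -(rmorphM (@conjC _)).
have rpsd v : 0 <= \sum_i \sum_j (v i)^* * v j *
     (disc_kernel b (x i) (x j) * (1 - \sum_q r i q * (r j q)^*)).
  have exe : 0 < e <= e0 by rewrite epos.
  have := psd e x exe (fun i => erefl) v; congr (0 <= _).
  apply: eq_bigr => i _; apply: eq_bigr => j _; congr (_ * (_ * (1 - _))).
  apply: eq_bigr => q _; rewrite rE /r exprMn.
  have -> : (theta * c q)%:C%C = (ga q)%:C%C * (ga q)%:C%C :> R[i].
    by rewrite -rmorphM -expr2 sqr_sqrtr ?thc.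
  by ring.
have [Phi [PhiM PhiE Phi1]] := H_pick (ltn0Sn N) (ltn0Sn N) (pick_row_psd H rpsd).
pose psi q z := Phi z 0 q.
have psiM q : is_multiplier H (psi q) by exact: PhiM.
pose a q := taylor_coef (psi q).
have aP q : has_power_series (psi q) (a q) by exact: (taylor_coefP b_adm (psiM q)).
have psiE q i : psi q (x i) = r i q by rewrite /psi PhiE mxE eqxx mul1r.
(* This bound is independent of e: by contractivity each entry sends the constant 1 to a vector of
   norm at most 1. *)
have aB q j : `|a q j| <= ((B + 1) * 2 ^+ j)%:C%C.
  have [g gE] := (psiM q).1 (monomial H 0).
  have <- : coef g j = a q j.
    by rewrite (mul_monomial_coef b_adm j (aP q) gE) subn0.
  have g1 : `|g| ^+ 2 <= 1.
    have := @mx_mul_row _ Phi 0 (fun p => (p == q)%:R *: monomial H 0)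
      (fun p => (p == q)%:R *: g) Phi1 PhiM.
    rewrite (bigD1 q)//= big1 => [|p /negPf ->]; last by rewrite scale0r.
    rewrite (bigD1 q)//= big1 => [|p /negPf ->]; last by rewrite scale0r normr0 expr0n.
    rewrite eqxx !scale1r !addr0 monomial_norm b0 invr1; apply => p.
    have [->|_] := eqVneq p q; first by rewrite !scale1r.
    rewrite !scale0r /mul_graph !linear0; apply/funext => z /=.
    by rewrite mulr0.
  have := coef_norm_le g j => cg.
  have X1 : 1 <= (B + 1) * 2 ^+ j.
    have h1 : 1 <= B + 1 by rewrite lerDr ltW.
    apply: le_trans h1 _; rewrite ler_peMr ?exprn_ege1 ?ler1n//.
    by rewrite addr_ge0// ltW.
  have X0 : 0 <= (B + 1) * 2 ^+ j by apply: le_trans X1.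
  rewrite -(@ler_pXn2r _ 2) ?nnegrE// ?ler0c//.
  apply: le_trans cg _; apply: (@le_trans _ _ (b j)%:C%C).
    by rewrite ler_piMr// ler0c ltW.
  rewrite -rmorphXn lecR; apply: le_trans (bB j) _.
  apply: (@le_trans _ _ ((B + 1) * 2 ^+ j)); first by rewrite ler_wpM2r ?exprn_ge0// lerDl.
  by rewrite expr2 ler_peMr.
pose K := 2 * (B + 1) * 2 ^+ N.+1.
have K0 : 0 < K by rewrite !mulr_gt0 ?exprn_gt0// addr_gt0.
have eC : 0 < e%:C%C :> R[i] by rewrite ltcR.
(* A discrete Fourier sum over the circle isolates the coefficient of degree q, times e^q, up to a
   tail of order e^(N+1); dividing by e^q leaves a factor e since q <= N. *)
have dist_a (q : 'I_N.+1) : `|(ga q)%:C%C - a q q| <= (K * e)%:C%C.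
  pose D i := psi q (x i) - \sum_(j < N.+1) a q j * sval (x i) ^+ j.
  have Dn i : `|D i| <= K%:C%C * e%:C%C ^+ N.+1.
    have x4 : `|sval (x i)| <= (1 / 4)%:C%C by rewrite [sval _]/= en lecR.
    by have := pseries_tail N.+1 (aB q) x4 (aP q (x i)); rewrite [sval _]/= en.
  have DS : \sum_i D i * (w ^+ (i * q))^* =
      ((ga q)%:C%C - a q q) * (N.+1%:R * e%:C%C ^+ q).
    have DE (i : 'I_N.+1) : D i * (w ^+ (i * q))^* =
        (ga q)%:C%C * e%:C%C ^+ q * (w ^+ (i * q) * (w ^+ (i * q))^*) -
        \sum_(j < N.+1) a q j * e%:C%C ^+ j * (w ^+ (i * j) * (w ^+ (i * q))^*).
      rewrite /D psiE mulrBl mulr_suml /r /=; congr (_ - _).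
        by rewrite exprMn -exprM; ring.
      by apply: eq_bigr => j _; rewrite exprMn -exprM; ring.
    rewrite (eq_bigr _ (fun i _ => DE i)) sumrB -mulr_sumr.
    rewrite (prim_root_orthogonality wP)// eqxx exchange_big /=.
    rewrite (bigD1 q)//= [X in _ - (_ + X)]big1 => [|j jq].
      by rewrite -mulr_sumr (prim_root_orthogonality wP)// ?eqxx !mul1r addr0; ring.
    rewrite -mulr_sumr (prim_root_orthogonality wP)// (inj_eq val_inj).
    by rewrite (negPf jq) mul0r mulr0.
  have NC : 0 < N.+1%:R * e%:C%C ^+ q :> R[i] by rewrite mulr_gt0 ?exprn_gt0.
  rewrite -(ler_pM2r NC) -[X in `|_| * X](gtr0_norm NC) -normrM -DS.
  apply: le_trans (ler_norm_sum _ _ _) _.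
  apply: (@le_trans _ _ (\sum_(i < N.+1) K%:C%C * e%:C%C ^+ N.+1)).
    apply: ler_sum => i _.
    by rewrite normrM norm_conjC normrX (norm_prim_root wP) expr1n mulr1 Dn.
  rewrite sumr_const card_ord -[leLHS]mulr_natl.
  rewrite [leRHS](_ : _ = N.+1%:R * (K%:C%C * e%:C%C ^+ q.+1)); last first.
    by rewrite exprS (_ : (K * e)%:C%C = K%:C%C * e%:C%C) ?rmorphM//; ring.
  apply: ler_wpM2l; first exact: ler0n.
  apply: ler_wpM2l; first by rewrite ler0c ltW.
  by apply: ler_wiXn2l; rewrite ?ltW// ltcR; lra.
pose al (q : 'I_N.+1) := complex.Re `|a q q|.
have alE q : (al q)%:C%C = `|a q q| by exact: normc_RRe.
have al0 q : 0 <= al q by rewrite -ler0c alE.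
have al_ge (q : 'I_N.+1) : theta * c q - 2 * ga q * K * e <= al q ^+ 2.
  have h : ga q - al q <= K * e.
    rewrite -lecR; apply: le_trans (dist_a q); rewrite rmorphB /= alE.
    have ga0 : 0 <= (ga q)%:C%C :> R[i] by rewrite ler0c sqrtr_ge0.
    by rewrite -[X in X - _](ger0_norm ga0) lerB_dist.
  rewrite -(sqr_sqrtr (thc q (ltn_ord q))) -/(ga q).
  rewrite (_ : 2 * ga q * K * e = 2 * ga q * (K * e)); last by ring.
  by apply: sqr_lower_bound h; rewrite ?sqrtr_ge0// mulr_ge0// ltW.
pose T := \sum_(q < N.+1) al q ^+ 2 * b (N.+1 - q).
have T0 : 0 <= T by apply: sumr_ge0 => q _; rewrite mulr_ge0 ?exprn_ge0 ?(ltW (b_gt0 _)).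
suff Tb : T <= b N.+1.
  apply: le_trans Tb; apply: ler_sum => q _; apply: ler_wpM2r; last exact: al_ge.
  exact: ltW.
(* The test column has squared norm T, and its product with the row has coefficient T in degree N+1;
   [coef_norm_le] then yields T^2 <= b_(N+1) T. *)
pose f q := ((a q q)^* * (b (N.+1 - q))%:C%C) *: monomial H (N.+1 - q).
have [g gE] := choice (fun q : 'I_N.+1 => (psiM q).1 (monomial H (N.+1 - q))).
pose G := \sum_q ((a q q)^* * (b (N.+1 - q))%:C%C) *: g q.
have Gn : `|G| ^+ 2 <= T%:C%C.
  apply: le_trans (mx_mul_row (p := 0) (f := f) Phi1 PhiM _) _.
    move=> q; rewrite /mul_graph !linearZ; apply/funext => z /=.
    by rewrite gE /GRing.scale /= mulrCA.
  rewrite /T rmorph_sum; apply: ler_sum => q _ /=.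
  rewrite /f normrZ exprMn monomial_norm normrM norm_conjC exprMn -alE.
  rewrite normc_real (gtr0_norm (b_gt0 _)) rmorphM rmorphXn /=.
  have bq : (b (N.+1 - q))%:C%C != 0 :> R[i] by rewrite fmorph_eq0 gt_eqF.
  by rewrite le_eqVlt; apply/orP; left; apply/eqP; field.
have GT : coef G N.+1 = T%:C%C.
  rewrite coef_sum /T rmorph_sum; apply: eq_bigr => q _ /=.
  rewrite (mul_monomial_coef b_adm N.+1 (aP q) (gE q)) leq_subr subKn ?(ltnW (ltn_ord q))//.
  by rewrite rmorphM rmorphXn /= alE normCK; ring.
have := coef_norm_le G N.+1; rewrite GT normc_real (ger0_norm T0).
have bN : 0 <= (b N.+1)%:C%C :> R[i] by rewrite ler0c ltW.
move=> /le_trans/(_ (ler_wpM2l bN Gn)); rewrite -rmorphXn -rmorphM lecR expr2.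
move=> TT; have [T00|Tn0] := eqVneq T 0; first by rewrite T00 ltW.
by rewrite ler_pM2r// lt_neqAle eq_sym Tn0 in TT.
Qed.

Lemma renewal_ge0 n : 0 <= c n.
Proof.
elim/ltn_ind: n => -[_|N IH]; first by rewrite renewal0.
have [K K0 circle] := pick_on_circle N.
rewrite leNgt; apply/negP => cN.
pose S := \sum_(q < N.+1) c q * b (N.+1 - q).
have cE : c N.+1 = b N.+1 - S by rewrite renewal_eq subr0.
have bN := b_gt0 N.+1.
have S0 : 0 < S by lra.
(* theta S is the midpoint of b_(N+1) and S, which keeps theta < 1 and theta S > b_(N+1). *)
pose theta := (b N.+1 / S + 1) / 2.
have th : theta * S = (b N.+1 + S) / 2 by rewrite /theta; field; rewrite gt_eqF.
have bS : b N.+1 / S < 1 by rewrite ltr_pdivrMr// mul1r; lra.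
have bS0 : 0 < b N.+1 / S by rewrite divr_gt0.
have th01 : 0 < theta < 1 by rewrite /theta; lra.
have [e0 e00 He] := circle theta th01 IH.
pose Q := \sum_(q < N.+1) 2 * Num.sqrt (theta * c q) * K * b (N.+1 - q).
have Q0 : 0 <= Q.
  by apply: sumr_ge0 => q _; rewrite !mulr_ge0 ?sqrtr_ge0 ?(ltW K0) ?ltW.
(* Small enough for the error Q e to stay below the gap theta S - b_(N+1). *)
pose d := (theta * S - b N.+1) / (2 * (Q + 1)).
have num : 0 < theta * S - b N.+1 by rewrite th; lra.
have Q1 : 0 < Q + 1 by rewrite ltr_wpDl.
have d0 : 0 < d by rewrite divr_gt0 ?mulr_gt0.
have me : 0 < Num.min e0 d <= e0 by rewrite lt_min e00 d0 ge_min lexx.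
have := He _ me; set e := Num.min e0 d.
have ed : e <= d by rewrite /e ge_min lexx orbT.
rewrite (_ : \sum_(q < N.+1) _ = theta * S - Q * e); last first.
  rewrite /S /Q mulr_sumr mulr_suml -sumrB; apply: eq_bigr => q _.
  by ring.
have : Q * e <= Q * d by rewrite ler_wpM2l.
have : 2 * ((Q + 1) * d) = theta * S - b N.+1.
  by rewrite /d; field; rewrite gt_eqF// ltr_wpDl.
nra.
Qed.

End CompletePick.

(** * The kernel on the diagonal *)

Lemma clamp_lipschitz (R : realDomainType) (x y s t : R) : x <= y -> s <= t ->
  0 <= Num.min (Num.max t x) y - Num.min (Num.max s x) y <= t - s.
Proof.
move=> xy st; case: (lerP s x) => h1; case: (lerP t x) => h2;
  case: (lerP x y) => h3; case: (lerP s y) => h4; case: (lerP t y) => h5; lra.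
Qed.

Section KernelOnRadius.
Variables (R : realType) (b : nat -> R) (b_adm : admissible b).
Implicit Types (x y z : R).

Local Notation c := (renewal b).

Let b_gt0 j : 0 < b j. Proof. by have [_ /(_ j)] := b_adm. Qed.
Let b0 : b 0%N = 1. Proof. by have [] := b_adm. Qed.

(** The argument stands for |z|^2, not for |z|. *)
Definition radial x := limn (pseries b x).

Lemma radial_le x M : 0 <= x < 1 ->
  (forall n, \sum_(j < n) b j * x ^+ j <= M) -> radial x <= M.
Proof.
move=> x01 h; apply: limr_le; first exact: admissible_cvg.
by apply: nearW => n; rewrite /pseries /series /= big_mkord.
Qed.

Lemma radial_ge x n : 0 <= x < 1 -> \sum_(j < n) b j * x ^+ j <= radial x.
Proof. exact: pseries_partial_le. Qed.

Lemma radial_ge1 x : 0 <= x < 1 -> 1 <= radial x.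
Proof.
by move=> x01; apply: le_trans (radial_ge 1 x01); rewrite big_ord1 b0 mulr1.
Qed.

Lemma radial_slope x y : 0 <= x -> x < y -> y < 1 ->
  radial x + b 1%N * (y - x) <= radial y.
Proof.
move=> x0 xy y1; have y0 : 0 <= y by apply: le_trans (ltW xy).
rewrite -lerBrDr; apply: radial_le => [|n]; first by rewrite x0 (lt_trans xy).
rewrite lerBrDr; apply: le_trans (radial_ge n.+2 _); last by rewrite y0.
rewrite -(big_mkord xpredT (fun j => b j * x ^+ j)) -(big_mkord xpredT (fun j => b j * y ^+ j)).
apply: (@le_trans _ _ (\sum_(0 <= j < n.+2) b j * x ^+ j + b 1%N * (y - x))).
  rewrite lerD2r [leRHS](big_cat_nat (n := n))//=; last by rewrite leqW// leqW.
  by rewrite lerDl sumr_ge0// => j _; rewrite mulr_ge0 ?exprn_ge0// ltW.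
rewrite !big_nat_recl// !expr0 !expr1.
rewrite -!addrA lerD2l mulrBr addrC -addrA subrK addrC lerD2l.
apply: ler_sum => j _; rewrite ler_wpM2l ?(ltW (b_gt0 _))//.
by rewrite lerXn2r ?nnegrE// ltW.
Qed.

Lemma radial_lt x y : 0 <= x -> x < y -> y < 1 -> radial x < radial y.
Proof.
move=> x0 xy y1; apply: lt_le_trans (radial_slope x0 xy y1).
by rewrite ltrDl mulr_gt0 ?subr_gt0.
Qed.

Lemma expr_convex x y z j : 0 <= x -> x <= y -> y <= z ->
  (z - x) * y ^+ j <= (z - y) * x ^+ j + (y - x) * z ^+ j.
Proof.
move=> x0 xy yz; elim: j => [|j IH]; first by rewrite !expr0; lra.
have y0 : 0 <= y by apply: le_trans xy.
have xz : x ^+ j <= z ^+ j.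
  by rewrite lerXn2r ?nnegrE; lra.
have := ler_wpM2r y0 IH; rewrite !exprSr => h.
have h1 : 0 <= (z - y) * (y - x) by rewrite mulr_ge0// subr_ge0.
have h2 : 0 <= z ^+ j - x ^+ j by rewrite subr_ge0.
have := mulr_ge0 h1 h2; nra.
Qed.

Lemma radial_convex x y z : 0 <= x -> x < y -> y < z -> z < 1 ->
  (z - x) * radial y <= (z - y) * radial x + (y - x) * radial z.
Proof.
move=> x0 xy yz z1; have zx : 0 < z - x by lra.
rewrite mulrC -ler_pdivlMr//; apply: radial_le => [|n]; first by lra.
rewrite ler_pdivlMr// mulr_suml.
have xn := @radial_ge x n; have zn := @radial_ge z n.
apply: (@le_trans _ _ ((z - y) * (\sum_(j < n) b j * x ^+ j) + (y - x) * (\sum_(j < n) b j * z ^+ j))).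
  rewrite !mulr_sumr -big_split; apply: ler_sum => j _ /=.
  have h := expr_convex j x0 (ltW xy) (ltW yz).
  rewrite [leLHS](_ : _ = b j * ((z - x) * y ^+ j)); last by ring.
  rewrite [leRHS](_ : _ = b j * ((z - y) * x ^+ j + (y - x) * z ^+ j)); last by ring.
  by rewrite ler_wpM2l// ltW.
by apply: lerD; rewrite ler_wpM2l ?xn ?zn//; lra.
Qed.

(** Convexity bounds the slopes on [x, y] by means of a point z beyond y, hence a Lipschitz
    estimate; clamping to [x, y] gives a function continuous on the whole line, to which [IVT]
    applies. *)
Lemma radial_ivt x y v : 0 <= x -> x <= y -> y < 1 ->
  radial x <= v <= radial y -> exists2 t, x <= t <= y & radial t = v.
Proof.
move=> x0 xy y1 xvy.
pose z := (1 + y) / 2.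
have yz : y < z by rewrite /z; lra.
have z1 : z < 1 by rewrite /z; lra.
pose L := radial z / (z - y).
have zy : 0 < z - y by lra.
have Rz : 1 <= radial z by apply: radial_ge1; lra.
have L0 : 0 < L by rewrite divr_gt0//; lra.
have lip s t : x <= s -> s <= t -> t <= y -> `|radial t - radial s| <= L * (t - s).
  move=> xs; rewrite le_eqVlt => /orP[/eqP ->|st] ty; first by rewrite !subrr normr0 mulr0.
  have s0 : 0 <= s by lra.
  have t1 : t < 1 by lra.
  rewrite ger0_norm ?subr_ge0 ?(ltW (radial_lt s0 st t1))//.
  have tz : t < z by lra.
  have cv := radial_convex s0 st tz z1.
  have s1 : 1 <= radial s by apply: radial_ge1; lra.
  have zt : 0 < z - t by lra.
  rewrite /L mulrAC ler_pdivlMr//.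
  have ge : 0 <= radial t - radial s by rewrite subr_ge0 ltW// radial_lt.
  have : (radial t - radial s) * (z - y) <= (radial t - radial s) * (z - t).
    by rewrite ler_wpM2l//; lra.
  move/le_trans; apply.
  have := mulr_ge0 (ltW (_ : 0 < t - s)) (_ : 0 <= radial t); nra.
pose cl t := Num.min (Num.max t x) y.
have clE t : x <= t <= y -> cl t = t.
  by move=> /andP[xt ty]; rewrite /cl max_l// min_l.
have cl_in t : x <= cl t <= y.
  by rewrite /cl le_min xy le_max lexx orbT ge_min lexx orbT.
have cl_mono s t : s <= t -> 0 <= cl t - cl s <= t - s.
  by move=> st; exact: clamp_lipschitz.
have cont : continuous (radial \o cl).
  move=> t; apply/cvgrPdist_lt => e e0.
  have d0 : 0 < e / L by rewrite divr_gt0.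
  near=> s.
  have ts : `|t - s| < e / L by near: s; exact: cvgr_dist_lt.
  rewrite ltr_pdivlMr// mulrC in ts; apply: le_lt_trans ts => /=.
  have /andP[sx sy] := cl_in s; have /andP[tx ty] := cl_in t.
  have [st|/ltW ts] := leP s t.
    have /andP[h1 h2] := cl_mono _ _ st.
    apply: le_trans (lip _ _ sx _ ty) _; first by rewrite -subr_ge0.
    by rewrite ger0_norm ?subr_ge0// ler_wpM2l// ltW.
  have /andP[h1 h2] := cl_mono _ _ ts.
  rewrite distrC; apply: le_trans (lip _ _ tx _ sy) _; first by rewrite -subr_ge0.
  by rewrite distrC ger0_norm ?subr_ge0// ler_wpM2l// ltW.
have [||t tin tv] := @IVT R (radial \o cl) x y v xy.
- exact: continuous_subspaceT.
- rewrite /= !clE ?lexx ?xy// ge_min le_max; case/andP: xvy => -> ->.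
  by rewrite orbT.
- by exists t; [rewrite in_itv in tin|rewrite -tv /= clE//; rewrite in_itv in tin].
Unshelve. all: by end_near. Qed.

Hypothesis c_ge0 : forall n, 0 <= c n.

Lemma partial_power_sum x N : (0 < N)%N ->
  \sum_(p < N) b p * x ^+ p = 1 +
    \sum_(m < N) c m * x ^+ m * \sum_(l < (N - m)%N) b l * x ^+ l.
Proof.
move=> N0; rewrite (renewal_sum b0 (fun p => x ^+ p) N0) expr0; congr (_ + _).
apply: eq_bigr => m _; rewrite -mulrA; congr (_ * _); rewrite mulr_sumr.
by apply: eq_bigr => l _; rewrite exprD; ring.
Qed.

Lemma partial_sum_ge0 x n : 0 <= x -> 0 <= \sum_(j < n) b j * x ^+ j.
Proof.
by move=> x0; apply: sumr_ge0 => j _; rewrite mulr_ge0 ?exprn_ge0// ltW.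
Qed.

(** All terms being nonnegative, a long partial sum of the convolution contains the product of
    shorter ones; this is F k <= k - 1 for partial sums of F. *)
Lemma renewal_radial x n : 0 <= x < 1 ->
  (\sum_(m < n) c m * x ^+ m) * radial x <= radial x - 1.
Proof.
move=> x01; have /andP[x0 x1] := x01.
set C := \sum_(m < n) _.
have C0 : 0 <= C by apply: sumr_ge0 => m _; rewrite mulr_ge0 ?exprn_ge0.
have step m : C * \sum_(j < m) b j * x ^+ j <= radial x - 1.
  have := radial_ge (n + m).+1 x01; rewrite partial_power_sum// => h.
  rewrite lerBrDl; apply: le_trans h; rewrite lerD2l.
  rewrite -(big_mkord xpredT (fun p => c p * x ^+ p * \sum_(l < ((n + m).+1 - p)%N) b l * x ^+ l)).
  rewrite (big_cat_nat (n := n))//=; last by rewrite leqW// leq_addr.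
  rewrite ler_wpDr//; last first.
    rewrite big_mkord mulr_suml; apply: ler_sum => i _.
    rewrite ler_wpM2l ?mulr_ge0 ?exprn_ge0//.
    rewrite -(big_mkord xpredT (fun j => b j * x ^+ j)).
    rewrite -[leRHS](big_mkord xpredT (fun j => b j * x ^+ j)).
    have mi : (m <= (n + m).+1 - i)%N by have := ltn_ord i; lia.
    rewrite [leRHS](big_cat_nat (n := m))//= lerDl sumr_ge0// => j _.
    by rewrite mulr_ge0 ?exprn_ge0// ltW.
  apply: sumr_ge0 => i _; rewrite mulr_ge0 ?partial_sum_ge0//.
  by rewrite mulr_ge0 ?exprn_ge0.
have [C00|Cn0] := eqVneq C 0.
  by rewrite C00 mul0r subr_ge0 radial_ge1.
have Cp : 0 < C by rewrite lt_neqAle eq_sym Cn0.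
rewrite mulrC -ler_pdivlMr//; apply: radial_le => // m.
by rewrite ler_pdivlMr// mulrC step.
Qed.

(** The reverse comparison: a truncated convolution is at most the product of the truncated sums. *)
Lemma renewal_partial x n : 0 <= x ->
  (\sum_(j < n) b j * x ^+ j) * (1 - \sum_(m < n) c m * x ^+ m) <= 1.
Proof.
move=> x0; case: n => [|n]; first by rewrite !big_ord0 mul0r.
set B := \sum_(j < n.+1) _; rewrite mulrBr mulr1 lerBlDr {1}/B.
rewrite partial_power_sum// lerD2l mulr_sumr; apply: ler_sum => m _.
rewrite mulrC ler_wpM2r ?mulr_ge0 ?exprn_ge0// /B.
rewrite -(big_mkord xpredT (fun j => b j * x ^+ j)).
rewrite -[leRHS](big_mkord xpredT (fun j => b j * x ^+ j)).
rewrite [leRHS](big_cat_nat (n := (n.+1 - m)%N)) ?leq_subr//= lerDl sumr_ge0// => j _.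
by rewrite mulr_ge0 ?exprn_ge0// ltW.
Qed.

Lemma expr_bernoulli (d : R) n : 0 <= d <= 1 -> 1 - n%:R * d <= (1 - d) ^+ n.
Proof.
move=> /andP[d0 d1]; elim: n => [|n IH]; first by rewrite mul0r subr0 expr0.
rewrite exprS -natr1; have n0 : 0 <= n%:R :> R by [].
have := ler_wpM2l (_ : 0 <= 1 - d) IH; rewrite subr_ge0 => /(_ d1).
have := mulr_ge0 n0 (mulr_ge0 d0 d0); lra.
Qed.

Lemma sum_renewal_le1 n : \sum_(m < n) c m <= 1.
Proof.
set S := \sum_(m < n) _; rewrite leNgt; apply/negP => S1.
have S0 : 0 < S by lra.
have n1 : 0 < n%:R + 1 :> R by rewrite ltr_wpDl.
have iS : S^-1 < 1 by rewrite invf_lt1.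
have iS0 : 0 < S^-1 by rewrite invr_gt0.
(* Chosen so that (1 - n d) S = 1 + d S > 1; by Bernoulli the sum at 1 - d then exceeds 1, while
   [renewal_radial] keeps it below 1. *)
pose d := (1 - S^-1) / (n%:R + 1).
have dn : d * (n%:R + 1) = 1 - S^-1 by rewrite /d divfK// gt_eqF.
have n0 : 0 <= n%:R :> R by [].
have d0 : 0 < d by rewrite divr_gt0//; lra.
have d1 : d <= 1 by have := mulr_ge0 (ltW d0) n0; lra.
have x01 : 0 <= 1 - d < 1 by lra.
have R1 := radial_ge1 x01.
have /= := renewal_radial n x01; set C := \sum_(m < n) _ => h.
have C1 : C < 1.
  rewrite ltNge; apply/negP => C1.
  have r0 : 0 <= radial (1 - d) by lra.
  by have := ler_wpM2r r0 C1; lra.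
have SC : (1 - d) ^+ n * S <= C.
  rewrite /S /C mulr_sumr; apply: ler_sum => m _; rewrite mulrC ler_wpM2l//.
  by apply: ler_wiXn2l; [lra|lra|exact: ltnW].
have db : 0 <= d <= 1 by rewrite ltW.
have be := expr_bernoulli n db.
have : (1 - n%:R * d) * S <= (1 - d) ^+ n * S by rewrite ler_wpM2r// ltW.
have : (1 - n%:R * d) * S = 1 + d * S.
  rewrite (_ : n%:R * d = 1 - S^-1 - d); last by rewrite -dn; ring.
  by field; rewrite gt_eqF.
have := mulr_gt0 d0 S0; lra.
Qed.

(** As c_0 = 0 and the total mass is at most 1, the mass beyond c_1 is at most 1 - c_1 and has
    weight at most 1/81. *)
Lemma sum_renewal_ninth n :
  \sum_(m < n) c m * (1 / 9) ^+ m <= c 1%N / 9 + (1 - c 1%N) / 81.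
Proof.
have h m : \sum_(i < m.+2) c i * (1 / 9) ^+ i <= c 1%N / 9 + (1 - c 1%N) / 81.
  have := sum_renewal_le1 m.+2.
  rewrite !big_ord_recl /= renewal0// expr0 mul0r !add0r expr1 => h.
  rewrite mul1r lerD2l.
  have : \sum_(i < m) c (bump 0 (bump 0 i)) <= 1 - c 1%N by rewrite lerBrDl.
  move=> h2; apply: (@le_trans _ _ ((\sum_(i < m) c (bump 0 (bump 0 i))) / 81)); last first.
    by rewrite ler_pM2r// invr_gt0.
  rewrite mulr_suml; apply: ler_sum => i _; apply: ler_wpM2l => //.
  have -> : (9^-1 : R) ^+ bump 0 (bump 0 i) = 81^-1 * 9^-1 ^+ i.
    by rewrite /bump /= !add1n !exprS; field.
  by rewrite ler_piMr ?invr_ge0// exprn_ile1//; lra.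
apply: le_trans (h n); rewrite -(big_mkord xpredT (fun i => c i * (1 / 9) ^+ i)).
rewrite -[leRHS](big_mkord xpredT (fun i => c i * (1 / 9) ^+ i)).
rewrite [leRHS](big_cat_nat (n := n))//=; last by rewrite leqW// leqW.
by rewrite lerDl sumr_ge0// => i _; rewrite mulr_ge0 ?exprn_ge0.
Qed.

Lemma radial_ninth_mul : radial (1 / 9) * (1 - (c 1%N / 9 + (1 - c 1%N) / 81)) <= 1.
Proof.
have c1 : c 1%N <= 1.
  have := sum_renewal_le1 2; rewrite !big_ord_recr big_ord0 /= renewal0//; lra.
have c0 := c_ge0 1.
have p : 0 < 1 - (c 1%N / 9 + (1 - c 1%N) / 81) by lra.
have h01 : 0 <= (1 / 9 : R) < 1 by lra.
rewrite -ler_pdivlMr//; apply: radial_le => // n; rewrite ler_pdivlMr//.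
have x0 : 0 <= (1 / 9 : R) by lra.
apply: le_trans (renewal_partial n x0); apply: ler_wpM2l; first exact: partial_sum_ge0.
by have := sum_renewal_ninth n; lra.
Qed.

Lemma radial_ninth_le : radial (1 / 9) <= 9 / 8.
Proof.
have c1 : c 1%N <= 1.
  have := sum_renewal_le1 2; rewrite !big_ord_recr big_ord0 /= renewal0//; lra.
have c0 := c_ge0 1.
have r1 : 1 <= radial (1 / 9) by apply: radial_ge1; lra.
have := radial_ninth_mul; nra.
Qed.

(** Equality forces c_1 = 1, which exhausts the total mass; the later c_m vanish and the renewal
    identity reads b_(n+1) = b_n. *)
Lemma radial_ninth_eq : radial (1 / 9) = 9 / 8 -> forall n, b n = 1.
Proof.
move=> r98; have := radial_ninth_mul; rewrite r98 => h.
have c1_ge : 1 <= c 1%N by lra.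
have c1 : c 1%N = 1.
  have := sum_renewal_le1 2; rewrite !big_ord_recr big_ord0 /= renewal0//; lra.
have c2 m : c m.+2 = 0.
  have := sum_renewal_le1 m.+3; rewrite big_ord_recr /= !big_ord_recl /= renewal0//.
  rewrite c1 => h2; have := c_ge0 m.+2.
  have : 0 <= \sum_(i < m) c (bump 0 (bump 0 i)) by apply: sumr_ge0.
  by lra.
elim=> [//|n IH]; rewrite (renewalE b0) add0r big_ord_recl big_ord_recl /=.
rewrite renewal0// mul0r c1 mul1r /bump /= ?addn0 ?add1n subSS subn0 IH add0r.
by rewrite big1 ?addr0// => i _; rewrite !add1n c2 mul0r.
Qed.

End KernelOnRadius.

(** * The Bohr set *)

Lemma rmorph_renewal (F F' : fieldType) (f : {rmorphism F -> F'}) (b : nat -> F) n :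
  renewal (fun j => f (b j)) n = f (renewal b n).
Proof.
elim/ltn_ind: n => n IH; rewrite !renewal_eq !rmorphB rmorph_nat rmorph_sum.
by congr (_ - _); apply: eq_bigr => q _; rewrite rmorphM IH.
Qed.

Lemma sharp_parameters (R : rcfType) (K : R) : 9 / 8 < K -> exists s a : R,
  [/\ 0 < s, s < 1, 0 < a < 1, s ^+ 2 = 1 - K^-1 & 1 < s * (1 + 2 * a)].
Proof.
move=> K98; have K0 : 0 < K by lra.
have iK0 : 0 < K^-1 by rewrite invr_gt0.
have iK : 1 / 9 < 1 - K^-1.
  have : K^-1 < (9 / 8)^-1 by rewrite ltf_pV2// posrE; lra.
  by rewrite invf_div; lra.
pose s := Num.sqrt (1 - K^-1).
have s2 : s ^+ 2 = 1 - K^-1 by rewrite sqr_sqrtr//; lra.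
have s0 : 0 <= s by exact: sqrtr_ge0.
have s1 : s < 1 by nra.
have s3 : 1 / 3 < s by nra.
have sp : 0 < s by lra.
(* The midpoint of (1 - s) / (2 s) and 1, between which s (1 + 2 a) > 1; the interval is nonempty
   because s > 1/3. *)
exists s, ((1 + s) / (4 * s)); split=> //.
  rewrite ltr_pdivrMr ?divr_gt0 ?mulr_gt0//; lra.
rewrite (_ : s * _ = s + (1 + s) / 2); first by lra.
by field; rewrite gt_eqF.
Qed.

Section BohrSet.
Variables (R : realType) (b : nat -> R) (b_adm : admissible b).
Variable H : rkhs (@disc_kernel R b).
Implicit Types (z : disc R) (phi : disc R -> R[i]).

Local Notation c := (renewal b).

Let b_gt0 j : 0 < b j. Proof. by have [_ /(_ j)] := b_adm. Qed.
Let b0 : b 0%N = 1. Proof. by have [] := b_adm. Qed.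

Lemma disc_norm z : exists2 x : R, `|sval z| = x%:C%C & 0 <= x < 1.
Proof.
have z1 : `|sval z| < 1 by case: (z).
have [x zx x0] := ge0_complexP (normr_ge0 (sval z)).
by exists x => //; rewrite x0 -ltcR -zx.
Qed.

Lemma kernel_diag z x : `|sval z| = x%:C%C ->
  disc_kernel b z z = (radial b (x ^+ 2))%:C%C.
Proof.
move=> zx; have [y zy y01] := disc_norm z.
have xy : x = y by apply: (@complexI R); rewrite -zx zy.
rewrite /disc_kernel ps_kernelE mulrC -normCK zx -[_ ^+ 2]rmorphXn /=.
by rewrite kernel_series_real//; nra.
Qed.

Lemma kernel_origin z (o : disc R) : sval o = 0 -> disc_kernel b o z = 1.
Proof.
move=> o0; have h : 0 <= (0 : R) < 1 by rewrite lexx ltr01.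
rewrite /disc_kernel ps_kernelE o0 mulr0.
apply: (cvg_complex_unique (kernel_series_cvg b_adm _)).
  by rewrite normr0 ltr01.
apply/cvg_complexP => e e0; exists 1%N => -[//|n] _.
rewrite /series /= big_nat_recl// expr0 b0 mulr1 big1 => [|j _].
  by rewrite addr0 subrr normr0 ltcR.
by rewrite exprS mul0r mulr0.
Qed.

Lemma majorantP phi z (M : R) : (majorant phi z <= M%:E)%E <->
  forall n, \sum_(j < n) `|taylor_coef phi j| * `|sval z| ^+ j <= M%:C%C.
Proof.
pose t j := complex.Re `|taylor_coef phi j * sval z ^+ j|.
have t0 j : 0 <= t j by rewrite -ler0c normc_RRe.
have tE n : \sum_(j < n) `|taylor_coef phi j| * `|sval z| ^+ j =
    (\sum_(0 <= j < n) t j)%:C%C.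
  rewrite big_mkord rmorph_sum; apply: eq_bigr => j _ /=.
  by rewrite normc_RRe normrM normrX.
split=> [mM n|sM].
  rewrite tE lecR -lee_fin -sumEFin; apply: le_trans mM.
  by apply: nneseries_lim_ge => j _ _; rewrite lee_fin.
apply: lime_le.
  apply: is_cvg_nneseries => j _ _.
  by rewrite lee_fin; exact: t0.
apply: nearW => n; rewrite sumEFin lee_fin -lecR -tE.
exact: sM.
Qed.

Hypothesis c_ge0 : forall n, 0 <= c n.

Lemma renewal_complex (V : nat -> R[i]) N : (0 < N)%N ->
  \sum_(p < N) (b p)%:C%C * V p = V 0%N +
    \sum_(m < N) (c m)%:C%C * \sum_(l < (N - m)%N) (b l)%:C%C * V (m + l)%N.
Proof.
move=> N0; have b0C : (b 0%N)%:C%C = 1 :> R[i] by rewrite b0.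
rewrite (@renewal_sum _ (fun j => (b j)%:C%C) b0C V N N0); congr (_ + _); apply: eq_bigr => m _.
by rewrite (rmorph_renewal (real_complex R)).
Qed.

Lemma bohr_set_sub z x : `|sval z| = x%:C%C -> radial b (x ^+ 2) <= 9 / 8 ->
  bohr_set H z.
Proof.
move=> zx rx phi phiM; apply/majorantP => n.
have [y zy y01] := disc_norm z.
have x01 : 0 <= x < 1.
  by have -> : x = y by apply: (@complexI R); rewrite -zx zy.
have x201 : 0 <= x ^+ 2 < 1 by nra.
have aP := taylor_coefP b_adm phiM; set a := taylor_coef phi in aP *.
have [M0 bM] := mult_norm_bound phiM.
set M := mult_norm H phi in M0 bM *.
have a0M : `|a 0%N| <= M%:C%C.
  have := mult_defect_ge0 b_adm 1 (fun=> 1) phiM (conj M0 bM) aP.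
  rewrite /defect_form big_ord1 b0 mul1r /defect /pairing big_ord1 /shift !mul1r conjC1 mulr1.
  by rewrite -normCK subr_ge0 ler_pXn2r// nnegrE// ler0c.
pose t := \sum_(j < n) complex.Re `|a j| * x ^+ j.
have tE : \sum_(j < n) `|a j| * `|sval z| ^+ j = t%:C%C.
  rewrite rmorph_sum; apply: eq_bigr => j _ /=.
  by rewrite rmorphM rmorphXn /= normc_RRe zx.
(* [bohr_inequality] needs |a_0| strictly below the bound, so it is applied with M + e for every e >
   0. *)
rewrite tE lecR; apply/ler_addgt0Pr => e e0; rewrite -lecR -tE zx.
have Me : M < M + e by rewrite ltrDl.
apply: (@bohr_inequality _ (fun j => (b j)%:C%C) (fun j => (c j)%:C%C)).
- by rewrite b0.
- by move=> j; rewrite ler0c ltW.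
- by move=> j; rewrite ler0c.
- by rewrite renewal0.
- exact: renewal_complex.
- move=> N xi; apply: (mult_defect_ge0 b_adm N xi phiM _ aP); split.
    by rewrite addr_ge0// ltW.
  move=> f g fg; apply: le_trans (bM _ _ fg) _.
  by rewrite ler_wpM2r// lecR ltW.
- by rewrite ler0c; case/andP: x01.
- move=> N; have := renewal_radial b_adm c_ge0 N x201.
  have -> : \sum_(m < N) (c m)%:C%C * x%:C%C ^+ (2 * m) =
      (\sum_(m < N) c m * (x ^+ 2) ^+ m)%:C%C :> R[i].
    rewrite rmorph_sum; apply: eq_bigr => m _.
    have -> : (x ^+ 2) ^+ m = x ^+ (2 * m) by rewrite exprM.
    have -> : x%:C%C ^+ (2 * m) = (x ^+ (2 * m))%:C%C :> R[i] by rewrite [RHS]rmorphXn.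
    by rewrite -rmorphM.
  set C := \sum_(m < N) _; have r1 := radial_ge1 b_adm x201 => h.
  have -> : 9 * C%:C%C = (9 * C)%:C%C :> R[i] by rewrite [RHS]rmorphM rmorph_nat.
  rewrite -(rmorph1 (real_complex R)) lecR.
  have C0 : 0 <= C.
    by apply: sumr_ge0 => m _; rewrite mulr_ge0 ?exprn_ge0//; case/andP: x01.
  nra.
- by apply: le_lt_trans a0M _; rewrite ltcR.
Qed.

Hypothesis H_pick : complete_pick H.

Lemma bohr_set_sup z x : `|sval z| = x%:C%C -> 9 / 8 < radial b (x ^+ 2) ->
  ~ bohr_set H z.
Proof.
move=> zx Kx zB.
set K := radial b (x ^+ 2) in Kx.
have [s [a [s0 s1 a01 s2 a2]]] := sharp_parameters Kx.
have /andP[a0 a1] := a01.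
have das : 0 < 1 - a * s by rewrite subr_gt0 mulr_ilt1// ltW.
have a21 : 0 <= 1 - a ^+ 2 by rewrite subr_ge0 expr_le1 ?ltW.
(* The real number at pseudo-hyperbolic distance s from a, which makes the two-point Pick problem
   extremal. *)
pose w := (a - s) / (1 - a * s).
have z01 : 0 <= (0 : R) < 1 by rewrite lexx ltr01.
pose o : disc R := disc_point (real_disc_lt1 z01).
have oE : sval o = 0 by [].
pose x2 (i : 'I_2) : disc R := if i == 0 then o else z.
pose r (i : 'I_2) (q : 'I_1) : R[i] := if i == 0 then a%:C%C else w%:C%C.
have k00 : disc_kernel b o o = 1.
  exact: kernel_origin.
have k01 : disc_kernel b o z = 1 by exact: kernel_origin.
have k10 : disc_kernel b z o = 1.
  by rewrite (kernelC H) k01 conjC1.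
have rpsd v : 0 <= \sum_i \sum_j (v i)^* * v j *
     (disc_kernel b (x2 i) (x2 j) * (1 - \sum_q r i q * (r j q)^*)).
  have realR (y : R) : (y%:C%C : R[i])^* = y%:C%C.
    by apply: conj_Creal; apply/complex_realP; exists y.
  rewrite !big_ord_recl !big_ord0 /= !addr0 /x2 /r /= !realR.
  rewrite k00 k01 k10 (kernel_diag zx) -/K.
  set v0 := v ord0; set v1 := v _.
  pose p := (1 - a * s)^-1.
  pose A : R[i] := (1 - a ^+ 2)%:C%C.
  have e1 : 1 - w%:C%C * a%:C%C = A * p%:C%C :> R[i].
    rewrite -(rmorph1 (real_complex R)) -!rmorphM -rmorphB; congr (_%:C%C).
    by rewrite /w /p; field; rewrite gt_eqF.
  have e2 : K%:C%C * (1 - w%:C%C * w%:C%C) = A * (p%:C%C * p%:C%C) :> R[i].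
    rewrite -(rmorph1 (real_complex R)) -!rmorphM -rmorphB -!rmorphM; congr (_%:C%C).
    have s21 : 1 - s ^+ 2 != 0 by rewrite gt_eqF// subr_gt0 expr_lt1// ltW.
    have -> : K = (1 - s ^+ 2)^-1 by rewrite s2 opprB addrC subrK invrK.
    by rewrite /w /p; field; rewrite (gt_eqF das).
  have e3 : 1 - a%:C%C * a%:C%C = A :> R[i].
    by rewrite /A rmorphB rmorph1 -rmorphM.
  rewrite [a%:C%C * w%:C%C]mulrC e1 e2 e3.
  (* The Pick matrix has rank one, so its form is a perfect square. *)
  rewrite (_ : _ + _ = A * `|v0 + p%:C%C * v1| ^+ 2).
    by rewrite mulr_ge0 ?exprn_ge0// ler0c.
  rewrite normCK; have -> : (v0 + p%:C%C * v1)^* = v0^* + p%:C%C * v1^*.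
    by rewrite (rmorphD (@conjC _)) (rmorphM (@conjC _)) /= realR.
  by ring.
have [Phi [PhiM PhiE Phi1]] := H_pick (ltn0Sn 1) (ltn0Sn 0) (pick_row_psd H rpsd).
pose phi u := Phi u 0 0.
have phiM : is_multiplier H phi by exact: PhiM.
have phi1 : mul_bound H phi 1.
  split=> // f g fg.
  have := mx_mul_row (p := 0) (f := fun=> f) (g := fun=> g) Phi1 PhiM _.
  rewrite !big_ord1 mul1r => h.
  rewrite -(@ler_pXn2r _ 2) ?nnegrE//; apply: h => q.
  by rewrite (ord1 q).
have phio : phi o = a%:C%C.
  by have := PhiE 0; rewrite /x2 /= /phi => ->; rewrite mxE eqxx mul1r.
have phiz : phi z = w%:C%C.
  by have := PhiE 1; rewrite /x2 /= /phi => ->; rewrite mxE eqxx mul1r.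
have aP := taylor_coefP b_adm phiM.
have m1 : (majorant phi z <= 1%:E)%E.
  by apply: le_trans (zB _ phiM) _; rewrite lee_fin; exact: mult_norm_le.
have sumle := iffLR (majorantP phi z 1) m1.
set al := taylor_coef phi in aP sumle.
have al0 : al 0%N = a%:C%C.
  rewrite -phio; apply: cvg_complex_unique (aP o).
  apply/cvg_complexP => e e0; exists 1%N => -[//|n] _.
  rewrite /series /= big_nat_recl// expr0 mulr1 big1 => [|j _].
    by rewrite addr0 subrr normr0 ltcR.
  by rewrite exprS mul0r mulr0.
(* The majorant at z is at most 1 and its first term is a, which leaves 1 - a for all the others. *)
have dist : `|phi z - al 0%N| <= (1 - a)%:C%C.
  apply: (@cvg_complex_norm_le _
    (fun n => series (fun j => al j * sval z ^+ j) n - al 0%N) _ _ 1).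
    exact: (cvg_complexD (aP z) (@cvg_complex_cst _ _)).
  move=> -[//|n] _; rewrite /series /= big_nat_recl// expr0 mulr1 addrAC subrr add0r.
  apply: le_trans (ler_norm_sum _ _ _) _.
  have := sumle n.+1; rewrite big_ord_recl expr0 mulr1 al0 normc_real gtr0_norm//.
  rewrite rmorphB rmorph1 /= -lerBrDl; apply: le_trans.
  rewrite big_mkord le_eqVlt; apply/orP; left; apply/eqP; apply: eq_bigr => j _.
  by rewrite normrM normrX.
move: dist; rewrite phiz al0 -rmorphB normc_real lecR.
have -> : w - a = - (s * (1 - a ^+ 2) / (1 - a * s)).
  by rewrite /w; field; rewrite gt_eqF.
rewrite normrN ger0_norm; last first.
  by rewrite divr_ge0 ?mulr_ge0// ltW.
rewrite ler_pdivrMr//.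
(* After cancelling 1 - a the bound reads s (1 + a) <= 1 - a s, against the choice of a. *)
have -> : s * (1 - a ^+ 2) = (1 - a) * (s * (1 + a)) by ring.
rewrite ler_pM2l ?subr_gt0// => le.
have lt : 1 - a * s < s * (1 + a).
  rewrite -subr_gt0 (_ : _ - _ = s * (1 + 2 * a) - 1) ?subr_gt0//.
  by ring.
by have := le_lt_trans le lt; rewrite ltxx.
Qed.

End BohrSet.

Lemma ps_kernel_real (R : realType) (b : nat -> R) (rho : R) :
  admissible b -> 0 <= rho < 1 ->
  ps_kernel b rho%:C%C rho%:C%C = (radial b (rho ^+ 2))%:C%C.
Proof.
move=> b_adm /andP[r0 r1]; rewrite ps_kernelE.
have -> : (rho%:C%C)^* * rho%:C%C = (rho ^+ 2)%:C%C :> R[i].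
  by rewrite mulrC -normCK normc_real ger0_norm// [RHS]rmorphXn.
by rewrite (kernel_series_real b_adm)// exprn_ge0//= expr_lt1.
Qed.

Lemma kernel_series_geometric (R : realType) (b : nat -> R) (t : R[i]) :
  admissible b -> (forall n, b n = 1) -> `|t| < 1 -> kernel_series b t = 1 / (1 - t).
Proof.
move=> b_adm b1 t1; set L := kernel_series b t.
have cL := kernel_series_cvg b_adm t1; rewrite -/L in cL.
have c2 : (series (fun j => (b j)%:C%C * t ^+ j) : nat -> R[i]^o) @ \oo --> (1 + t * L : R[i]^o).
  have /cvg_complexP h := cvg_complexD (@cvg_complex_cst _ 1) (cvg_complexMl (c := t) cL).
  apply/cvg_complexP => e /h[N HN]; exists N.+1 => -[//|n] /HN /=.
  rewrite /series /= [in X in _ -> X]big_nat_recl// expr0 b1 mulr1 mulr_sumr.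
  rewrite (eq_bigr (fun j => (b j.+1)%:C%C * t ^+ j.+1))// => j _.
  by rewrite !b1 exprS; ring.
have LE := cvg_complex_unique cL c2.
have t10 : 1 - t != 0.
  by rewrite subr_eq0; apply/eqP => t1'; rewrite -t1' normr1 ltxx in t1.
by apply: (canRL (mulfK t10)); rewrite mulrBr mulr1 {1}LE; ring.
Qed.

Theorem corollary3 (R : realType) (b : nat -> R) (b_adm : admissible b)
    (H : rkhs (@disc_kernel R b)) (H_pick : complete_pick H) :
  [/\ (forall rho rho' : R, bohr_rho b rho -> bohr_rho b rho' -> rho = rho'),
      (forall rho : R, bohr_rho b rho ->
         bohr_set H = [set z : disc R | `|sval z| <= rho%:C%C]),
      (~ (exists rho : R, bohr_rho b rho) -> bohr_set H = setT)
    & (bohr_rho b (1 / 3) <->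
       forall z w : disc R, disc_kernel b z w = 1 / (1 - (sval w)^* * sval z))].
Proof.
have c_ge0 := renewal_ge0 b_adm H_pick.
have rhoP rho : bohr_rho b rho <-> 1 / 3 <= rho < 1 /\ radial b (rho ^+ 2) = 9 / 8.
  split=> -[r01 h]; split=> //; have r01' : 0 <= rho < 1 by lra.
    by move: h; rewrite ps_kernel_real// => /(@complexI R).
  by rewrite ps_kernel_real// h.
have radial_inj x y : 0 <= x < 1 -> 0 <= y < 1 ->
    radial b (x ^+ 2) <= radial b (y ^+ 2) -> x <= y.
  move=> /andP[x0 x1] /andP[y0 y1]; apply: contraTT; rewrite -!ltNge => yx.
  by apply: radial_lt => //; rewrite ?exprn_ge0// ?expr_lt1// ltrXn2r.
have bohrP z x : `|sval z| = x%:C%C ->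
    bohr_set H z <-> radial b (x ^+ 2) <= 9 / 8.
  move=> zx; split=> [zB|]; last exact: bohr_set_sub.
  by rewrite leNgt; apply/negP => /(bohr_set_sup b_adm H_pick zx).
split.
- move=> r r' /rhoP[r1 h] /rhoP[r1' h']; apply/eqP; rewrite eq_le.
  by apply/andP; split; apply: radial_inj; rewrite ?h ?h'//; lra.
- move=> rho /rhoP[r1 h]; apply/seteqP; split=> z /=;
    have [x zx x01] := disc_norm z; rewrite zx lecR.
    move=> /(bohrP _ _ zx); rewrite -h; apply: radial_inj => //; lra.
  move=> xr; apply/(bohrP _ _ zx); rewrite -h.
  move: xr; rewrite le_eqVlt => /orP[/eqP -> //|xr].
  apply/ltW/radial_lt => //; rewrite ?exprn_ge0 ?expr_lt1 ?ltrXn2r//; lra.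
- move=> no_rho; apply/seteqP; split=> // z _.
  have [x zx x01] := disc_norm z; apply/(bohrP _ _ zx); clear z zx.
  (* The kernel is at most 9/8 at t = 1/9, so a point where it exceeds 9/8 would yield a rho by the
     intermediate value theorem; t >= 1/9 gives rho >= 1/3. *)
  rewrite leNgt; apply/negP => gt.
  have r9 := radial_ninth_le b_adm c_ge0.
  have e9 : (1 / 9 : R) = (1 / 3) ^+ 2 by field.
  have x3 : 1 / 3 <= x.
    by apply: radial_inj => //; [lra|rewrite -e9; lra].
  have [||||t tx tv] := @radial_ivt R b b_adm (1 / 9) (x ^+ 2) (9 / 8).
  + by lra.
  + by rewrite e9 -subr_ge0 subr_sqr mulr_ge0//; lra.
  + by rewrite expr_lt1//; lra.
  + by rewrite r9 ltW.
  + apply: no_rho; exists (Num.sqrt t); apply/rhoP; rewrite sqr_sqrtr; last by lra.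
    split=> //; apply/andP; split.
      rewrite -[1 / 3](@ger0_norm R); last by lra.
      by rewrite -sqrtr_sqr ler_wsqrtr// -e9; case/andP: tx.
    rewrite -sqrtr1 ltr_sqrt//; apply: le_lt_trans (_ : x ^+ 2 < 1).
      by case/andP: tx.
    by rewrite expr_lt1//; lra.
- split=> [/rhoP[_ h] z w|h].
    have e9 : ((1 / 3) ^+ 2 : R) = 1 / 9 by field.
    rewrite e9 in h; have b1 := radial_ninth_eq b_adm c_ge0 h.
    rewrite /disc_kernel ps_kernelE kernel_series_geometric//.
    have z1 : `|sval z| < 1 by case: (z).
    have w1 : `|sval w| < 1 by case: (w).
    by rewrite normrM norm_conjC mulr_ilt1.
  split; first by lra.
  have r01 : 0 <= (1 / 3 : R) < 1 by lra.
  (* At z = w = 1/3 the Szego kernel equals 1 / (1 - 1/9) = 9/8. *)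
  have := h (disc_point (real_disc_lt1 r01)) (disc_point (real_disc_lt1 r01)).
  rewrite /disc_kernel /= => ->.
  rewrite [_^* * _]mulrC -normCK normc_real ger0_norm; last by lra.
  have -> : (1 / 3)%:C%C ^+ 2 = ((1 / 3) ^+ 2)%:C%C :> R[i] by rewrite [RHS]rmorphXn.
  rewrite -(rmorph1 (real_complex R)) -rmorphB -fmorph_div; congr (_%:C%C).
  by field.
Qed.
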